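(* Let $-\infty < \beta < \infty$. Let $X, X_1, X_2, \ldots$ be independent identically distributed real-valued random variables and $S_n = X_1 + \cdots + X_n$, $n \ge 1$. Put $$\beta(X) = \inf \left\{b \in \mathbb{R}:~ \mathbb{E} \left(\frac{|X|}{(L|X|)^{b}} \right) < \infty \right\}.$$ Then $$\limsup_{n \rightarrow \infty} \left| \frac{S_{n}}{n} \right|^{(\log \log n)^{-1}} = e^{\beta} \quad \text{almost surely}$$ if and only if the following condition holds: (a) if $\beta > 0$: $\beta(X) = \beta$; (b) if $\beta = 0$: either ($\mathbb{E}|X| < \infty$ and $\mathbb{E}X \neq 0$), or $\beta(X) = 0$; (c) if $\beta < 0$: $\mathbb{E}X = 0$ and $\beta(X) = \beta$. In particular, $\mathbb{E}|X| < \infty$ and $\mathbb{E}X \neq 0$ imply that $$\lim_{n\rightarrow\infty}\left|\frac{S_n}{n}\right|^{(\log\log n)^{-1}}=1 \quad \text{almost surely}.$$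
   Context: $\log$ is the natural logarithm and $Lx = \log(\max(e, x))$ for $x \ge 0$. The quantity $|\cdot|^{(\log\log n)^{-1}}$ is considered for $n \ge 3$. The infimum is taken in the extended reals over real $b$, with the infimum of the empty set equal to $+\infty$. The condition $\mathbb{E}X = 0$ includes that $\mathbb{E}X$ exists. *)

(* Defs.v *)
From HB Require Import structures.
From mathcomp Require Import all_boot all_order all_algebra.
From mathcomp Require Import all_classical all_reals all_analysis.
Import Order.TTheory GRing.Theory Num.Theory.
Import numFieldNormedType.Exports.

Set Implicit Arguments.
Unset Strict Implicit.
Unset Printing Implicit Defensive.

Local Open Scope classical_set_scope.
Local Open Scope ring_scope.

Section Defs.
Context d (T : measurableType d) (R : realType) (P : probability T R).

Definition mutually_independent (X : nat -> {RV P >-> R}) : Prop :=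
  forall (J : seq nat) (A : nat -> set R),
    uniq J -> (forall i, measurable (A i)) ->
    P (\bigcap_(i in [set` J]) (X i @^-1` A i)) =
    (\prod_(i <- J) P (X i @^-1` A i))%E.

Definition identically_distributed (X : nat -> {RV P >-> R}) : Prop :=
  forall (i j : nat) (A : set R), measurable A ->
    distribution P (X i) A = distribution P (X j) A.

Definition iid (X : nat -> {RV P >-> R}) : Prop :=
  mutually_independent X /\ identically_distributed X.

Definition Llog (x : R) : R := ln (Num.max (expR 1) x).

(* The infimum is taken in [\bar R], so it is [+oo] when no [b] qualifies and
   [-oo] when the set of such [b] is unbounded below. *)
Definition moment_exponent (X : {RV P >-> R}) : \bar R :=
  ereal_inf [set b%:E | b in
    [set b : R | ('E_P[fun w => (`|X w| / Llog `|X w| `^ b)%R] < +oo)%E]].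

(* [X 0] is reserved for the generic copy, so the sum starts at index 1. *)
Definition partial_sum (X : nat -> {RV P >-> R}) (n : nat) (w : T) : R :=
  \sum_(1 <= i < n.+1) X i w.

(* |S_n / n| ^ (1 / log log n); only the values at n >= 3, where
   log log n > 0, are meaningful, and the others affect no limit. *)
Definition normed_mean (X : nat -> {RV P >-> R}) (n : nat) (w : T) : R :=
  `|partial_sum X n w / n%:R| `^ (ln (ln n%:R))^-1.

End Defs.

(* Main.v *)
Require Import Defs.
From HB Require Import structures.
From mathcomp Require Import all_boot all_order all_algebra.
From mathcomp Require Import all_classical all_reals all_analysis.
From mathcomp Require Import measurable_realfun ring lra zify.
Import Order.TTheory GRing.Theory Num.Theory.
Set Implicit Arguments.
Unset Strict Implicit.
Unset Printing Implicit Defensive.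
Import numFieldNormedType.Exports.

Local Open Scope classical_set_scope.
Local Open Scope ring_scope.

(** For large [n] the inequality |S_n/n|^(1/loglog n) <= e^b means
    |S_n| <= n (log n)^b, so the limit superior is e^beta exactly when, almost
    surely, |S_n| <= n (log n)^b holds eventually for every b > beta and fails
    infinitely often for every b < beta ([ae_limsup_iff]).  Since b may be
    moved a little, constant factors never matter.  Put
    phi_b(x) = x / (Lx)^b; then phi_b(x) > n essentially says
    x > n (log n)^b, and E phi_b(|X|) < oo is equivalent to the convergence of
    the sum over n of P(phi_b(|X|) > n).

    If E phi_b(|X|) = oo, the second Borel-Cantelli lemma gives
    phi_b(|X_n|) > n infinitely often, hence |X_n| >= n (log n)^b infinitely
    often.  As X_n = S_n - S_(n-1), one of S_n, S_(n-1) is then comparably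
    large ([infinite_moment_no_growth]).

    If E phi_b(|X|) < oo and b >= 0, the variables Z_i = phi_b(|X_i|) are
    integrable, so Z_1 + ... + Z_n = O(n) ([sum_le_linear]: truncate at 2^k
    along n = 2^k and use Chebyshev's inequality and monotonicity).  In
    particular Z_i = O(n) for i <= n, so L|X_i| = O(log n), and summing
    |X_i| = Z_i (L|X_i|)^b gives |S_n| = O(n (log n)^b)
    ([finite_moment_growth]).

    If E phi_b(|X|) < oo, b <= 0 and EX = 0, the positive and negative parts
    are treated separately.  Let Y >= 0 be one of them and split Y_i into
    Y_i 1(Y_i^5 <= i) and Y_i 1(Y_i^5 > i).  The low parts have such small
    variances that Chebyshev's inequality along n = m^5, with monotone
    interpolation, bounds their centred sum by O(n^(4/5)).  On the high part
    log i <= 5 L Y_i, so it is at most a constant times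
    phi_b(Y_i) (log i)^b, and the O(n) bound for the sums of phi_b(Y_i)
    yields a total of O(n (log n)^b); the same computation bounds its mean
    ([sum_deviation_rate], [centered_growth]).  Monotonicity of the sums is
    what replaces a maximal inequality here.

    The same splitting, with the high parts dominated by Y_i 1(Y_i^5 > M) of
    small mean, gives the strong law of large numbers ([slln]); when EX is not
    zero it keeps |S_n| between n (log n)^(-b) and n (log n)^b for every
    b > 0 ([noncentered_growth]).  The theorem follows by comparing beta with
    the infimum of the set of all b with E phi_b(|X|) < oo, a set that is
    closed upwards. *)

(** * Independent copies *)

Section independence.
Context {R : realType} {d : measure_display} {T : measurableType d}.
Context {P : probability T R} {X : nat -> {RV P >-> R}}.

Lemma ge0_integral_eqdist (hX : iid X) (i j : nat) (g : R -> \bar R) :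
  measurable_fun [set: R] g -> (forall x, 0 <= g x)%E ->
  (\int[P]_w g (X i w) = \int[P]_w g (X j w))%E.
Proof.
move=> mg g0.
rewrite -(ge0_integral_distribution (X i) mg g0).
rewrite -(ge0_integral_distribution (X j) mg g0).
by apply: eq_measure_integral => A mA _; exact: hX.2.
Qed.

Lemma probability_eqdist (hX : iid X) (i j : nat) (A : set R) :
  measurable A -> P [set w | A (X i w)] = P [set w | A (X j w)].
Proof. by move=> mA; exact: (hX.2 i j A mA). Qed.

Lemma indep_probability2 (hX : iid X) (i j : nat) (A B : set R) :
  i != j -> measurable A -> measurable B ->
  (P (X i @^-1` A `&` X j @^-1` B) =
   P (X i @^-1` A) * P (X j @^-1` B))%E.
Proof.
move=> ij mA mB.
pose C k := if k == i then A else B.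
have := hX.1 [:: i; j] C.
rewrite /= inE ij => /(_ isT) H.
have mC k : measurable (C k) by rewrite /C; case: ifP.
have {H} := H mC.
rewrite big_cons big_seq1 /C eqxx eq_sym (negbTE ij) => <-.
congr (P _); apply/seteqP; split => w /=.
  move=> [Aw Bw] k /=; rewrite !inE => /orP[/eqP ->|/eqP ->]; rewrite ?eqxx//.
  by rewrite eq_sym (negbTE ij).
move=> H; split.
  by have := H i; rewrite /= eqxx inE eqxx; apply.
by have := H j; rewrite /= eq_sym (negbTE ij) !inE eqxx orbT; apply.
Qed.

(** The joint law of a pair agrees with the product of the marginals on rectangles,
    hence everywhere, and Tonelli's theorem applies. *)
Lemma indep_expectationM (hX : iid X) (i j : nat) (f h : R -> R) :
  i != j -> measurable_fun [set: R] f -> measurable_fun [set: R] h ->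
  (forall x, 0 <= f x) -> (forall x, 0 <= h x) ->
  (\int[P]_w (f (X i w) * h (X j w))%:E =
   \int[P]_w (f (X i w))%:E * \int[P]_w (h (X j w))%:E)%E.
Proof.
move=> ij mf mh f0 h0.
pose Y : T -> R * R := fun w => (X i w, X j w).
have mY : measurable_fun [set: T] Y by apply/measurable_fun_pairP; split.
pose F (z : R * R) : \bar R := (f z.1 * h z.2)%:E.
have mF : measurable_fun [set: R * R] F.
  apply/measurable_EFinP; apply: measurable_funM.
    exact: measurableT_comp.
  exact: measurableT_comp.
have F0 z : (0 <= F z)%E by rewrite lee_fin mulr_ge0.
pose Ym : {mfun T >-> (R * R)%type} := HB.pack Y (@isMeasurableFun.Build _ _ _ _ Y mY).
have := ge0_integral_distribution (P := P) Ym mF F0 => /= <-.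
have U := @product_measure_unique _ _ _ _ R (distribution P (X i)) (distribution P (X j))
  (distribution P Ym).
have -> : (\int[distribution P Ym]_y F y =
   \int[distribution P (X i) \x distribution P (X j)]_y F y)%E.
  apply: eq_measure_integral => A mA _; apply/esym; apply: U => // B C mB mC.
  by rewrite /= -indep_probability2.
rewrite fubini_tonelli1//= /fubini_F/F/=.
have E1 : (\int[P]_w (f (X i w))%:E = \int[distribution P (X i)]_x (f x)%:E)%E.
  by rewrite ge0_integral_distribution//; exact/measurable_EFinP.
have E2 : (\int[P]_w (h (X j w))%:E = \int[distribution P (X j)]_x (h x)%:E)%E.
  by rewrite ge0_integral_distribution//; exact/measurable_EFinP.
rewrite E1 E2.
have inner x : (\int[distribution P (X j)]_y (f x * h y)%:E =
    (f x)%:E * \int[distribution P (X j)]_y (h y)%:E)%E.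
  under eq_integral do rewrite EFinM.
  rewrite ge0_integralZl//; first exact/measurable_EFinP.
    by move=> y _; rewrite lee_fin.
  by rewrite lee_fin.
under eq_integral do rewrite inner.
rewrite ge0_integralZr//.
- exact/measurable_EFinP.
- by move=> y _; rewrite lee_fin.
- by apply: integral_ge0 => y _; rewrite lee_fin.
Qed.

End independence.

(** * Chebyshev's inequality for sums of independent functions *)

Section chebyshev_sum.
Context {R : realType} {d : measure_display} {T : measurableType d}.
Context {P : probability T R} {X : nat -> {RV P >-> R}}.

Lemma bounded_Lfun2 (Y : T -> R) (M : R) :
  measurable_fun [set: T] Y -> (forall w, `|Y w| <= M) -> Y \in Lfun P 2%:E.
Proof.
move=> mY YM; rewrite inE/=; apply/andP; split; rewrite inE//=.
rewrite /finite_norm unlock poweR_lty//.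
apply: (@le_lt_trans _ _ (\int[P]_w (M `^ 2)%:E)%E).
  apply: ge0_le_integral => //.
  - by move=> x _; rewrite lee_fin powR_ge0.
  - apply/measurable_EFinP.
    apply: (measurableT_comp (f := (@powR R)^~ 2)) => //.
    exact: measurableT_comp.
  - move=> x _ /=; rewrite lee_fin ge0_ler_powR// ?nnegrE//; first exact: le_trans (YM x).
by rewrite integral_cst//= probability_setT mule1 ltry.
Qed.

Variable f : nat -> R -> R.
Variable M : nat -> R.
Hypothesis hX : iid X.
Hypothesis mf : forall i, measurable_fun [set: R] (f i).
Hypothesis f0 : forall i x, 0 <= f i x.
Hypothesis fM : forall i x, f i x <= M i.

Let Y i : T -> R := fun w => f i (X i w).

Let mY i : measurable_fun [set: T] (Y i).
Proof. exact: measurableT_comp. Qed.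

Let Y2 i : Y i \in Lfun P 2%:E.
Proof.
apply: (bounded_Lfun2 (M := M i)) => [|w]; first exact: mY.
by rewrite ger0_norm; [exact: fM|exact: f0].
Qed.

Let Pfin : P [set: T] \is a fin_num. Proof. exact: fin_num_measure. Qed.

Let Y1 i : Y i \in Lfun P 1. Proof. exact: Lfun_subset12. Qed.

Let S (s : seq nat) : T -> R := fun w => \sum_(i <- s) Y i w.

Let S_cons i s : S (i :: s) = (Y i \+ S s)%R.
Proof. by apply/funext => w; rewrite /S big_cons. Qed.

Let S_nil : S [::] = cst 0.
Proof. by apply/funext => w; rewrite /S big_nil. Qed.

Let S2 s : S s \in Lfun P 2%:E.
Proof.
elim: s => [|i s IH]; first by rewrite S_nil Lfun_cst.
by rewrite S_cons rpredD// lee1n.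
Qed.

Let S1 s : S s \in Lfun P 1. Proof. exact: Lfun_subset12. Qed.

Let covY i j : i != j -> covariance P (Y i) (Y j) = 0%E.
Proof.
move=> ij; rewrite covarianceE//; last exact: Lfun2_mul_Lfun1.
rewrite [in X in (X - _)%E]unlock /=.
rewrite (indep_expectationM hX ij)// ![in X in (_ - X)%E]unlock subee//.
by rewrite fin_numM//; have := expectation_fin_num (Y1 i);
  have := expectation_fin_num (Y1 j); rewrite unlock.
Qed.

Let covYS i s : i \notin s -> covariance P (Y i) (S s) = 0%E.
Proof.
elim: s => [_|j s IH]; first by rewrite S_nil covariance_cst_r.
rewrite inE negb_or => /andP[ij iS].
by rewrite S_cons covarianceDr// covY// IH// adde0.
Qed.

(** Uncorrelated summands: the variance of the sum is the sum of the variances,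
    each at most a second moment. Boundedness makes all covariances meaningful. *)
Lemma variance_indep_sum_le (s : seq nat) : uniq s ->
  ('V_P[fun w => (\sum_(i <- s) f i (X i w))%R] <=
   \sum_(i <- s) \int[P]_w (f i (X 0%N w) ^+ 2)%:E)%E.
Proof.
change (uniq s -> ('V_P[S s] <=
   \sum_(i <- s) \int[P]_w (f i (X 0%N w) ^+ 2)%:E)%E).
elim: s => [_|i s IH /= /andP[iS us]].
  by rewrite S_nil big_nil variance_cst.
rewrite S_cons varianceD// covYS// mule0 adde0 big_cons leeD//; last exact: IH.
rewrite varianceE// [in X in (X - _)%E]unlock /=.
rewrite (ge0_integral_eqdist hX 0%N i (g := fun x => (f i x ^+ 2)%:E)); first last.
- by move=> x; rewrite lee_fin sqr_ge0.
- by apply/measurable_EFinP; exact: measurable_funX.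
rewrite leeBlDr ?leeDl//.
  by rewrite sqre_ge0.
by rewrite fin_numM// expectation_fin_num.
Qed.

Lemma expectation_indep_sum (s : seq nat) :
  ('E_P[fun w => (\sum_(i <- s) f i (X i w))%R] =
   (\sum_(i <- s) fine (\int[P]_w (f i (X 0%N w))%:E)%E)%R%:E)%E.
Proof.
change ('E_P[S s] = (\sum_(i <- s) fine (\int[P]_w (f i (X 0%N w))%:E)%E)%R%:E)%E.
elim: s => [|i s IH]; first by rewrite S_nil big_nil expectation_cst.
rewrite S_cons expectationD// IH big_cons EFinD; congr (_ + _)%E.
rewrite (ge0_integral_eqdist hX 0%N i (g := fun x => (f i x)%:E)) ?unlock; first last.
- by move=> x; rewrite lee_fin.
- exact/measurable_EFinP.
by rewrite fineK//; have := expectation_fin_num (Y1 i); rewrite unlock.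
Qed.

Lemma chebyshev_indep_sum (s : seq nat) (t : R) : uniq s -> 0 < t ->
  (P [set w | (t <= `|\sum_(i <- s) f i (X i w) -
       \sum_(i <- s) fine (\int[P]_w (f i (X 0%N w))%:E)%E|)%R] <=
   (t ^- 2)%:E * \sum_(i <- s) \int[P]_w (f i (X 0%N w) ^+ 2)%:E)%E.
Proof.
move=> us t0.
have mS : measurable_fun [set: T] (S s).
  by move: (S2 s); rewrite inE => /andP[]; rewrite inE.
pose Sm : {mfun T >-> R} := HB.pack (S s) (@isMeasurableFun.Build _ _ _ _ (S s) mS).
have := @chebyshev _ _ _ P Sm t t0.
have -> : ('E_P[Sm] = (\sum_(i <- s) fine (\int[P]_w (f i (X 0%N w))%:E)%E)%R%:E)%E.
  exact: expectation_indep_sum.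
move=> /= /le_trans; apply; rewrite lee_pmul2l//; last first.
  by rewrite lte_fin invr_gt0 exprn_gt0.
exact: variance_indep_sum_le.
Qed.

End chebyshev_sum.

(** * Borel-Cantelli and dyadic sums *)

(** The summability hypothesis is on partial sums with a real bound, the form in
    which the estimates below produce it. *)
Lemma borel_cantelli_ae {R : realType} {d : measure_display}
    {T : measurableType d} (P : probability T R) (F : nat -> set T) (C : R) :
  (forall k, measurable (F k)) ->
  (forall n, \sum_(0 <= k < n) P (F k) <= C%:E)%E ->
  \forall w \ae P, \forall k \near \oo, ~ F k w.
Proof.
move=> mF FC; exists (lim_sup_set F); split.
- by apply: bigcap_measurable => // k _; exact: bigcup_measurable.
- apply: lim_sup_set_cvg0 => //.
  rewrite (@le_lt_trans _ _ C%:E) ?ltry//.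
  apply: lime_le; last exact: nearW.
  exact: is_cvg_nneseries.
- move=> w /= H n _; apply: contrapT => nH; apply: H; exists n => // k /= nk Fk.
  by apply: nH; exists k.
Qed.

Lemma measurable_fun_le_cst {R : realType} {d : measure_display}
    {T : measurableType d} (h : T -> R) (c : R) :
  measurable_fun [set: T] h ->
  measurable_fun [set: T] (fun x => (h x <= c)%R%:R : R).
Proof.
move=> mh.
rewrite (_ : (fun x => _) = (\1_(`]-oo, c]%classic) : R -> R) \o h); last first.
  by apply/funext => x /=; rewrite indicE mem_setE in_itv.
by apply: measurableT_comp => //; exact: measurable_indic.
Qed.

Lemma measurable_fun_lt_cst {R : realType} {d : measure_display}
    {T : measurableType d} (h : T -> R) (c : R) :
  measurable_fun [set: T] h ->
  measurable_fun [set: T] (fun x => (c < h x)%R%:R : R).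
Proof.
move=> mh.
rewrite (_ : (fun x => _) = (\1_(`]c, +oo[%classic) : R -> R) \o h); last first.
  by apply/funext => x /=; rewrite indicE mem_setE in_itv /= andbT.
by apply: measurableT_comp => //; exact: measurable_indic.
Qed.

Section dyadic_sums.
Context {R : realType}.

(** The nonzero terms form a geometric progression ending below [y]. *)
Lemma dyadic_tail_sum (y : R) (n : nat) : 0 <= y ->
  \sum_(0 <= k < n) 2 ^+ k * (2 ^+ k < y)%R%:R <= 2 * y.
Proof.
move=> y0; elim: n => [|n IH]; first by rewrite big_nil mulr_ge0.
case: (ltP (2 ^+ n) y) => ny.
  have : \sum_(0 <= k < n.+1) 2 ^+ k * (2 ^+ k < y)%R%:R <= 2 ^+ n.+1 - 1 :> R.
    elim: n.+1 => [|m IHm]; first by rewrite big_nil expr0 subrr.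
    rewrite big_nat_recr//= exprS.
    have : (2 ^+ m < y)%R%:R <= 1 :> R by case: (2 ^+ m < y)%R.
    have : 0 <= 2 ^+ m :> R by rewrite exprn_ge0.
    by move: IHm; set a := 2 ^+ m; set b := (_ < _)%R%:R; nra.
  by rewrite exprS; move: ny; set a := 2 ^+ n; lra.
by rewrite big_nat_recr//= ltNge ny mulr0 addr0.
Qed.

(** The nonzero terms are [y ^+ 2] times a geometric progression that starts at
    the first power of 2 above [y]. *)
Lemma dyadic_truncated_square_sum (y : R) (n : nat) : 0 <= y ->
  \sum_(0 <= k < n) 2 ^- k * (y * (y <= 2 ^+ k)%R%:R) ^+ 2 <= 2 * y.
Proof.
move=> y0.
(* The added term is the sum of the whole remaining geometric tail, which makes
   the bound inductive. *)
suff : \sum_(0 <= k < n) 2 ^- k * (y * (y <= 2 ^+ k)%R%:R) ^+ 2 +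
    2 * 2 ^- n * (y * (y <= 2 ^+ n)%R%:R) ^+ 2 <= 2 * y.
  apply: le_trans; rewrite lerDl mulr_ge0 ?sqr_ge0// mulr_ge0//.
have p2 m : 0 < 2 ^+ m :> R by rewrite exprn_gt0.
elim: n => [|n IH].
  rewrite big_nil add0r expr0 invr1 mulr1.
  by case: (leP y 1) => y1 /=; [rewrite mulr1; nra|rewrite mulr0 expr0n/= mulr0; lra].
case: (leP y (2 ^+ n)) => yn.
  have yn' : y <= 2 ^+ n.+1 by rewrite exprS; have := p2 n; lra.
  move: IH; rewrite big_nat_recr//= yn yn' !mulr1; apply: le_trans.
  rewrite -addrA lerD2l (exprS 2 n) invfM.
  by set a := 2 ^- n; set b := y ^+ 2; lra.
rewrite big1_seq ?add0r.
  case: (leP y (2 ^+ n.+1)) => yn' /=; last first.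
    by rewrite mulr0 expr0n/= mulr0; lra.
  have -> : 2 * 2 ^- n.+1 = 2 ^- n :> R.
    by rewrite exprS invfM mulrA divff// mul1r.
  rewrite mulr1 mulrC ler_pdivrMr//.
  rewrite exprS in yn'.
  by have := p2 n; nra.
move=> k; rewrite mem_index_iota ltnS => /andP[_ /andP[_ kn]].
rewrite leNgt (le_lt_trans _ yn) ?mulr0 ?expr0n ?mulr0//.
by rewrite ler_eXn2l// ltr1n.
Qed.

End dyadic_sums.

(** * Linear growth of sums of nonnegative integrable variables *)

Lemma ge0_sume_const {R : realType} (I : Type) (s : seq I) (x : \bar R) :
  (0 <= x -> \sum_(i <- s) x = (size s)%:R%:E * x)%E.
Proof.
move=> x0; elim: s => [|i s IH]; first by rewrite big_nil mul0e.
by rewrite big_cons IH /= -natr1 EFinD ge0_muleDl// mul1e addeC.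
Qed.

Lemma measurable_gt_cst {R : realType} {d : measure_display}
    {T : measurableType d} (Y : T -> R) (c : R) :
  measurable_fun [set: T] Y -> measurable [set w | c < Y w].
Proof.
move=> mY; rewrite (_ : [set w | _] = [set: T] `&` Y @^-1` `]c, +oo[%classic).
  by apply: mY.
by apply/seteqP; split => w /=; rewrite in_itv/= andbT => // -[].
Qed.

Lemma measurable_ge_cst {R : realType} {d : measure_display}
    {T : measurableType d} (Y : T -> R) (c : R) :
  measurable_fun [set: T] Y -> measurable [set w | c <= Y w].
Proof.
move=> mY; rewrite (_ : [set w | _] = [set: T] `&` Y @^-1` `[c, +oo[%classic).
  by apply: mY.
by apply/seteqP; split => w /=; rewrite in_itv/= andbT => // -[].
Qed.

Section linear_growth.
Context {R : realType} {d : measure_display} {T : measurableType d}.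
Context {P : probability T R} {X : nat -> {RV P >-> R}}.

Lemma measurable_sum_comp (f : nat -> R -> R) (s : seq nat) :
  (forall i, measurable_fun [set: R] (f i)) ->
  measurable_fun [set: T] (fun w => \sum_(i <- s) f i (X i w)).
Proof. by move=> mf; apply: measurable_sum => i; exact: measurableT_comp. Qed.

Variable g : R -> R.
Hypothesis hX : iid X.
Hypothesis mg : measurable_fun [set: R] g.
Hypothesis g0 : forall x, 0 <= g x.

Lemma probability_gt_integral (i : nat) (c : R) :
  (P [set w | (c < g (X i w))%R] = \int[P]_w ((c < g (X 0%N w))%R%:R)%:E)%E.
Proof.
have mA : measurable [set x | c < g x] by exact: measurable_gt_cst.
rewrite (probability_eqdist hX i 0 mA) -[in LHS](setIT [set w | _]).
rewrite -integral_indic//; last first.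
  by apply: measurable_gt_cst; exact: measurableT_comp.
by apply: eq_integral => w _; rewrite indicE mem_setE.
Qed.

(** Exchanges sum and expectation: a pointwise linear bound on the sum of the
    [psi k] is all that Borel-Cantelli needs from the estimates [psi k]. *)
Lemma sum_integral_le (psi : nat -> R -> R) (C : R) (n : nat) :
  (forall k, measurable_fun [set: R] (psi k)) ->
  (forall k y, 0 <= y -> 0 <= psi k y) ->
  0 <= C ->
  (forall y, 0 <= y -> \sum_(0 <= k < n) psi k y <= C * y) ->
  (\sum_(0 <= k < n) \int[P]_w (psi k (g (X 0%N w)))%:E <=
   C%:E * \int[P]_w (g (X 0%N w))%:E)%E.
Proof.
move=> mpsi psi0 C0 psiC.
have mgX : measurable_fun [set: T] (fun w => g (X 0%N w)).
  exact: measurableT_comp.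
have mpsiX k : measurable_fun [set: T] (fun w => (psi k (g (X 0%N w)))%:E).
  by apply/measurable_EFinP; exact: measurableT_comp.
rewrite -ge0_integral_sum//; last by move=> k w _; rewrite lee_fin psi0.
rewrite -ge0_integralZl_EFin//; last 2 first.
- by move=> w _; rewrite lee_fin.
- exact/measurable_EFinP.
apply: ge0_le_integral => //.
- by move=> w _; apply: sume_ge0 => k _; rewrite lee_fin psi0.
- exact: emeasurable_sum.
- by apply/measurable_EFinP; exact: measurable_funM.
- by move=> w _; rewrite sumEFin -EFinM lee_fin psiC.
Qed.

(** Along n = 2^k, the sum exceeds n K only if some term exceeds 2^k or the sum
    of the terms truncated at 2^k exceeds its mean by the fraction K - E g of n.
    The probabilities of these two events are at most the expectation of
    [psi k] at g, and the [psi k] have a linearly bounded sum by the two dyadic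
    estimates. Monotonicity of the sums costs the factor 2 between powers of 2. *)
Lemma sum_le_linear (K : R) : (\int[P]_w (g (X 0%N w))%:E < K%:E)%E ->
  \forall w \ae P, \forall n \near \oo,
    \sum_(1 <= i < n.+1) g (X i w) <= 2 * K * n%:R.
Proof.
move=> gK.
set mu := (\int[P]_w (g (X 0%N w))%:E)%E in gK.
have mu0 : (0 <= mu)%E by apply: integral_ge0 => w _; rewrite lee_fin.
have mufin : mu \is a fin_num by rewrite ge0_fin_numE// (lt_trans gK)// ltry.
pose eta := K - fine mu.
have eta0 : 0 < eta by rewrite subr_gt0 -lte_fin fineK.
have K0 : 0 < K by rewrite -lte_fin (le_lt_trans mu0).
have p2 m : 0 < 2 ^+ m :> R by rewrite exprn_gt0.
pose tr k (y : R) : R := y * (y <= 2 ^+ k)%R%:R.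
have tr0 k y : 0 <= y -> 0 <= tr k y by move=> y0; rewrite mulr_ge0.
have tr_le_pow k y : 0 <= y -> tr k y <= 2 ^+ k.
  by rewrite /tr => y0; case: (leP y (2 ^+ k)) => /= h; rewrite ?mulr1 ?mulr0// ltW.
have tr_le k y : 0 <= y -> tr k y <= y.
  by move=> y0; rewrite /tr; case: (y <= _); rewrite /= ?mulr1 ?mulr0.
have mtr k : measurable_fun [set: R] (tr k).
  by apply: measurable_funM => //; exact: measurable_fun_le_cst.
pose psi k y : R := 2 ^+ k * (2 ^+ k < y)%R%:R + eta ^- 2 * (2 ^- k * tr k y ^+ 2).
pose bad k := [set w | 2 ^+ k * K < \sum_(1 <= i < (2 ^ k).+1) g (X i w)].
have mbad k : measurable (bad k).
  by apply: measurable_gt_cst; exact: (@measurable_sum_comp (fun=> g)).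
have badpsi k : (P (bad k) <= \int[P]_w (psi k (g (X 0%N w)))%:E)%E.
  pose s := index_iota 1 (2 ^ k).+1.
  pose f (i : nat) y := tr k (g y).
  pose t := 2 ^+ k * eta.
  have t0 : 0 < t by rewrite mulr_gt0.
  pose e := (\int[P]_w (f 0%N (X 0%N w))%:E)%E.
  have mf i : measurable_fun [set: R] (f i) by exact: measurableT_comp.
  have f0 i y : 0 <= f i y by exact: tr0.
  have e_mu : (e <= mu)%E.
    apply: ge0_le_integral => //.
    - by move=> w _; rewrite lee_fin.
    - by apply/measurable_EFinP; exact: measurableT_comp.
    - by apply/measurable_EFinP; exact: measurableT_comp.
    - by move=> w _; rewrite lee_fin tr_le.
  have e0 : (0 <= e)%E by apply: integral_ge0 => w _; rewrite lee_fin.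
  have efin : e \is a fin_num.
    by rewrite ge0_fin_numE// (le_lt_trans e_mu)// (lt_trans gK)// ltry.
  have := @chebyshev_indep_sum _ _ _ P X f (fun=> 2 ^+ k) hX mf f0
    (fun i y => tr_le_pow k _ (g0 y)) s t (iota_uniq _ _) t0.
  rewrite -/e big_const_seq count_predT size_iota subn1 /= iter_addr_0.
  set dev := [set w | _] => Pdev.
  pose U := \big[setU/set0]_(i < (2 ^ k)%N) [set w | 2 ^+ k < g (X i.+1 w)].
  have mdev : measurable dev.
    apply: measurable_ge_cst; apply: measurableT_comp => //.
    by apply: measurable_funB => //; exact: measurable_sum_comp.
  have mUi i : measurable [set w | 2 ^+ k < g (X i w)].
    by apply: measurable_gt_cst; exact: measurableT_comp.
  have mU : measurable U by apply: bigsetU_measurable => i _.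
  have sub : bad k `<=` dev `|` U.
    move=> w /= bw; case: (pselect (U w)) => [|nU]; first by right.
    left; rewrite /dev/=.
    have -> : \sum_(i <- s) f i (X i w) = \sum_(i <- s) g (X i w).
      apply: eq_big_seq => i; rewrite mem_index_iota => /andP[i1 ik].
      rewrite /f /tr; case: leP => h; first by rewrite mulr1.
      exfalso; apply: nU; rewrite /U.
      rewrite -(bigcup_mkord _ (fun i => [set w | 2 ^+ k < g (X i.+1 w)])).
      by exists i.-1; rewrite /= prednK.
    rewrite (le_trans _ (ler_norm _))// lerBrDr.
    apply: (le_trans _ (ltW bw)).
    rewrite /t -(mulr_natl (fine e)) natrX -mulrDr ler_wpM2l//.
    by rewrite /eta -lerBrDl opprB addrC subrK fine_le.
  apply: (@le_trans _ _ (P dev + P U)%E).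
    apply: (@le_trans _ _ (P (dev `|` U))).
      by apply: le_measure; rewrite ?inE//; exact: measurableU.
    exact: measureU2.
  have PU : (P U <= (2 ^+ k)%:E * \int[P]_w ((2 ^+ k < g (X 0%N w))%R%:R)%:E)%E.
    apply: (@le_trans _ _ (\sum_(i < (2 ^ k)%N) P [set w | (2 ^+ k < g (X i.+1 w))%R])%E).
      apply: (@content_subadditive _ _ _ P U
        (fun i => [set w | 2 ^+ k < g (X i.+1 w)])) => // i _; exact: mUi.
    under eq_bigr do rewrite probability_gt_integral.
    rewrite ge0_sume_const; last by apply: integral_ge0 => w _; rewrite lee_fin.
    by rewrite -[X in size X]enumT size_enum_ord natrX.
  rewrite addeC; apply: (le_trans (leeD PU Pdev)).
  pose q := (\int[P]_w (tr k (g (X 0%N w)) ^+ 2)%:E)%E.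
  have q0 : (0 <= q)%E by apply: integral_ge0 => w _; rewrite lee_fin sqr_ge0.
  have -> : (\sum_(i <- s) \int[P]_w (f i (X 0%N w) ^+ 2)%:E = (2 ^+ k)%:E * q)%E.
    by apply: (etrans (ge0_sume_const s q0)); rewrite size_iota subn1 /= natrX.
  rewrite muleA -EFinM (_ : t ^- 2 * 2 ^+ k = eta ^- 2 * 2 ^- k); last first.
    rewrite /t; move: (p2 k) eta0; set a := 2 ^+ k => a0 eta0.
    by field; rewrite !gt_eqF.
  rewrite /psi /q; under [leRHS]eq_integral do
    rewrite mulrA EFinD (EFinM (2 ^+ k)) (EFinM (eta ^- 2 / 2 ^+ k)).
  have mgX : measurable_fun [set: T] (g \o X 0%N) by exact: measurableT_comp.
  have m1 : measurable_fun [set: T] (fun w => (2 ^+ k < g (X 0%N w))%R%:R : R).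
    exact: measurable_fun_lt_cst.
  have m2 : measurable_fun [set: T] (fun w => tr k (g (X 0%N w)) ^+ 2).
    by apply: measurable_funX; exact: measurableT_comp.
  have c0 : 0 <= eta ^- 2 * 2 ^- k by rewrite mulr_ge0// invr_ge0 ?sqr_ge0// ltW.
  rewrite ge0_integralD//=; last 3 first.
  - by apply: measurable_funeM; exact/measurable_EFinP.
  - by move=> w _; rewrite -EFinM lee_fin mulr_ge0// sqr_ge0.
  - by apply: measurable_funeM; exact/measurable_EFinP.
  rewrite [in leRHS]ge0_integralZl_EFin ?(ltW (p2 k))//; last exact/measurable_EFinP.
  rewrite [in leRHS]ge0_integralZl_EFin//; last exact/measurable_EFinP.
  by move=> w _; rewrite lee_fin sqr_ge0.
have psi0 k y : 0 <= y -> 0 <= psi k y.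
  move=> y0; apply: addr_ge0; first by rewrite mulr_ge0// ltW.
  apply: mulr_ge0; first by rewrite invr_ge0 sqr_ge0.
  by apply: mulr_ge0; rewrite ?sqr_ge0// invr_ge0 ltW.
have mpsi k : measurable_fun [set: R] (psi k).
  apply: measurable_funD.
    by apply: measurable_funM => //; exact: measurable_fun_lt_cst.
  apply: measurable_funM => //; apply: measurable_funM => //.
  exact: measurable_funX.
have evbad : \forall w \ae P, \forall k \near \oo, ~ bad k w.
  apply: (@borel_cantelli_ae _ _ _ _ _ ((2 + eta ^- 2 * 2) * fine mu)) => // n.
  apply: (@le_trans _ _ (\sum_(0 <= k < n) \int[P]_w (psi k (g (X 0%N w)))%:E)%E).
    exact: lee_sum.
  rewrite EFinM fineK//; apply: sum_integral_le => //.
    by rewrite addr_ge0// mulr_ge0// invr_ge0 exprn_ge0// ltW.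
  move=> y y0; rewrite big_split/= mulrDl lerD ?dyadic_tail_sum//.
  rewrite -mulr_sumr -mulrA ler_wpM2l ?dyadic_truncated_square_sum//.
  by rewrite invr_ge0 exprn_ge0// ltW.
apply: filterS evbad => w [N _ HN].
exists (2 ^ N)%N => // n /= Nn.
have n0 : (0 < n)%N by apply: leq_trans Nn; rewrite expn_gt0.
pose k := trunc_log 2 n.
have /andP[kn nk] : (2 ^ k <= n < 2 ^ k.+1)%N by exact: trunc_log_bounds.
have Nk : (N <= k.+1)%N.
  rewrite -ltnS -(ltn_exp2l _ _ (isT : (1 < 2)%N)) (leq_ltn_trans Nn)//.
  by rewrite (ltn_trans nk)// ltn_exp2l.
have := HN k.+1 Nk; rewrite /bad/= => /negP; rewrite -leNgt => H.
apply: (@le_trans _ _ (\sum_(1 <= i < (2 ^ k.+1).+1) g (X i w))).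
  rewrite [leRHS](@big_cat_nat _ _ _ n.+1)//=; last by rewrite ltnS ltnW.
  by rewrite lerDl sumr_ge0.
apply: (le_trans H); rewrite exprS -!mulrA ler_wpM2l// mulrC ler_wpM2l ?(ltW K0)//.
by rewrite -natrX ler_nat.
Qed.

End linear_growth.

(** * Interpolation between fifth powers *)

Lemma nat_root_floor (p n : nat) : (0 < p)%N ->
  exists m, (m ^ p <= n < m.+1 ^ p)%N.
Proof.
move=> p0; have ex0 : exists m, (m ^ p <= n)%N by exists 0%N; rewrite exp0n.
have ub m : (m ^ p <= n -> m <= n)%N.
  by apply: leq_trans; rewrite -[leqLHS]expn1; case: m => // m; rewrite leq_pexp2l.
have [m mn mmax] := ex_maxnP ex0 ub; exists m; rewrite mn ltnNge /=.
by apply/negP => /mmax; rewrite ltnn.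
Qed.

Section sums.
Context {R : realType}.

Lemma sum_nat_le (a : nat -> R) (m n : nat) : (forall i, 0 <= a i) ->
  (m <= n)%N -> \sum_(1 <= i < m.+1) a i <= \sum_(1 <= i < n.+1) a i.
Proof.
move=> a0 mn; rewrite [leRHS](@big_cat_nat _ _ _ m.+1)//=.
by rewrite lerDl sumr_ge0.
Qed.

Lemma sum_nat_sub_le (e : nat -> R) (mu : R) (m n : nat) :
  (forall i, e i <= mu) -> (m <= n)%N ->
  \sum_(1 <= i < n.+1) e i <= \sum_(1 <= i < m.+1) e i + (n%:R - m%:R) * mu.
Proof.
move=> emu mn; rewrite [leLHS](@big_cat_nat _ _ _ m.+1)//= lerD2l.
apply: (@le_trans _ _ (\sum_(m.+1 <= i < n.+1) mu)); first exact: ler_sum.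
by rewrite sumr_const_nat subSS -natrB// mulr_natl.
Qed.

Lemma sum_inv_sqr_le (n : nat) :
  \sum_(0 <= k < n) (k.+1%:R ^- 2 : R) <= 2.
Proof.
suff H m : \sum_(0 <= k < m.+1) (k.+1%:R ^- 2 : R) <= 2 - m.+1%:R^-1.
  case: n => [|n]; first by rewrite big_nil.
  by apply: (le_trans (H n)); rewrite lerBlDr lerDl invr_ge0.
elim: m => [|m IH]; first by rewrite big_nat1 expr1n invr1; lra.
rewrite big_nat_recr//=; apply: (le_trans (lerD IH (lexx _))).
rewrite -addrA lerD2l -lerBrDl -[m.+2%:R]natr1.
have : 0 < m.+1%:R :> R by rewrite ltr0n.
set x := m.+1%:R => x0.
have -> : - (x + 1)^-1 - - x^-1 = x^-1 * (x + 1)^-1.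
  by field; rewrite !gt_eqF//; lra.
rewrite expr2 invfM ler_wpM2r ?invr_ge0//; first lra.
by rewrite lef_pV2 ?posrE//; lra.
Qed.

(** Between m^5 and (m+1)^5 both sums are monotone, and the centring moves by at
    most mu ((m+1)^5 - m^5) <= 31 mu m^4, the order of the deviation allowed at
    the fifth powers. The term 16 comes from (m+1)^4 <= 16 m^4. *)
Lemma interpolate_fifth_powers (a e : nat -> R) (mu : R) (N : nat) :
  (forall i, 0 <= a i) -> (forall i, 0 <= e i <= mu) ->
  (forall m, (N <= m)%N ->
     `|\sum_(1 <= i < (m.+1 ^ 5).+1) a i - \sum_(1 <= i < (m.+1 ^ 5).+1) e i| <=
     m.+1%:R ^+ 4) ->
  forall n, (N.+1 ^ 5 <= n)%N ->
    `|\sum_(1 <= i < n.+1) a i - \sum_(1 <= i < n.+1) e i| <=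
    (16 + 31 * mu) * n%:R `^ (4 / 5).
Proof.
move=> a0 emu H n Nn.
have e0 i : 0 <= e i by have /andP[] := emu i.
have ele i : e i <= mu by have /andP[] := emu i.
have mu0 : 0 <= mu by exact: le_trans (ele 0%N).
have [m /andP[mn nm]] := @nat_root_floor 5 n isT.
have Nm : (N < m)%N.
  by rewrite -ltnS -(ltn_exp2r _ _ (isT : (0 < 5)%N)) (leq_ltn_trans Nn).
case: m Nm mn nm => // m; rewrite ltnS => Nm mn nm.
have /ler_normlP[H1 H1'] := H m Nm; have /ler_normlP[H2 H2'] := H m.+1 (leqW Nm).
have A1 := sum_nat_le a0 mn; have A2 := sum_nat_le a0 (ltnW nm).
have E1 := sum_nat_sub_le ele mn; have E2 := sum_nat_sub_le ele (ltnW nm).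
have mx : m.+1%:R ^+ 4 <= n%:R `^ (4 / 5) :> R.
  have -> : m.+1%:R ^+ 4 = (m.+1 ^ 5)%:R `^ (4 / 5) :> R.
    rewrite natrX -!powR_mulrn// -powRrM; congr (_ `^ _).
    by rewrite mulrCA divff// mulr1.
  by rewrite ge0_ler_powR// ?nnegrE// ler_nat.
apply: (@le_trans _ _ ((16 + 31 * mu) * m.+1%:R ^+ 4)); last first.
  by rewrite ler_wpM2l// addr_ge0// mulr_ge0.
have nlo : m.+1%:R ^+ 5 <= n%:R :> R by rewrite -natrX ler_nat.
have nhi : n%:R <= m.+2%:R ^+ 5 :> R by rewrite -natrX ler_nat ltnW.
rewrite !natrX in E1 E2.
rewrite -[m.+2%:R]natr1 in nhi E2 H2 H2' *.
move: nlo nhi A1 A2 E1 E2 H1 H1' H2 H2'.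
have : 1 <= m.+1%:R :> R by rewrite ler1n.
set x := m.+1%:R; set N' := n%:R.
set An := \sum_(1 <= i < n.+1) a i; set En := \sum_(1 <= i < n.+1) e i.
set Am := \sum_(1 <= i < (m.+1 ^ 5).+1) a i.
set Em := \sum_(1 <= i < (m.+1 ^ 5).+1) e i.
set Ap := \sum_(1 <= i < (m.+2 ^ 5).+1) a i.
set Ep := \sum_(1 <= i < (m.+2 ^ 5).+1) e i.
move=> x1 nlo nhi A1 A2 E1 E2 H1 H1' H2 H2'.
have x41 : (x + 1) ^+ 4 <= 16 * x ^+ 4.
  have -> : 16 * x ^+ 4 = (2 * x) ^+ 4 by ring.
  by rewrite lerXn2r// ?nnegrE; lra.
have gap : (x + 1) ^+ 5 - x ^+ 5 <= 31 * x ^+ 4.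
  have -> : (x + 1) ^+ 5 - x ^+ 5 = 5 * x ^+ 4 + 10 * x ^+ 3 + 10 * x ^+ 2 + 5 * x + 1.
    by ring.
  have x2 : x <= x ^+ 2 by nra.
  have x3 : x ^+ 2 <= x ^+ 3 by rewrite (exprS x 2); nra.
  have x4 : x ^+ 3 <= x ^+ 4 by rewrite (exprS x 3) ler_peMl// exprn_ge0//; lra.
  lra.
have g1 : ((x + 1) ^+ 5 - N') * mu <= 31 * x ^+ 4 * mu by rewrite ler_wpM2r//; lra.
have g2 : (N' - x ^+ 5) * mu <= 31 * x ^+ 4 * mu by rewrite ler_wpM2r//; lra.
have xp : 0 <= x ^+ 4 by rewrite exprn_ge0//; lra.
by apply/ler_normlP; split; rewrite mulrDl mulrAC; lra.
Qed.

End sums.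

(** * Truncation at the fifth root of the index *)

Section truncation.
Context {R : realType}.

(** The cutoff is the fifth root of [i]: at i = m^5 the low part is at most m, so
    a deviation of m^4 has probability at most m^5 * m * E g / m^8, which is
    summable in m, while m^4 has the order of the gap between fifth powers.
    Comparing [g x ^+ 5] with [i] keeps all exponents integral. *)
Definition low (g : R -> R) (i : nat) (x : R) : R := g x * (g x ^+ 5 <= i%:R)%R%:R.
Definition high (g : R -> R) (i : nat) (x : R) : R := g x * (i%:R < g x ^+ 5)%R%:R.

Variable g : R -> R.
Hypothesis mg : measurable_fun [set: R] g.
Hypothesis g0 : forall x, 0 <= g x.

Lemma low_add_high i x : low g i x + high g i x = g x.
Proof. by rewrite -mulrDr ltNge; case: (_ <= _); rewrite /= ?addr0 ?add0r mulr1. Qed.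

Lemma low_ge0 i x : 0 <= low g i x. Proof. exact: mulr_ge0. Qed.

Lemma high_ge0 i x : 0 <= high g i x. Proof. exact: mulr_ge0. Qed.

Lemma low_le i x : low g i x <= g x.
Proof. by rewrite -[leRHS](low_add_high i) lerDl high_ge0. Qed.

Lemma high_le i x : high g i x <= g x.
Proof. by rewrite -[leRHS](low_add_high i) lerDr low_ge0. Qed.

Lemma low_root_le (m i : nat) x : (i <= m ^ 5)%N -> low g i x <= m%:R.
Proof.
move=> im; rewrite /low; case: (leP (g x ^+ 5) i%:R) => h; last by rewrite mulr0.
rewrite mulr1 -(@ler_pXn2r _ 5)// ?nnegrE//.
by apply: (le_trans h); rewrite -natrX ler_nat.
Qed.

Lemma measurable_low i : measurable_fun [set: R] (low g i).
Proof.
by apply: measurable_funM => //; apply: measurable_fun_le_cst; exact: measurable_funX.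
Qed.

Lemma measurable_high i : measurable_fun [set: R] (high g i).
Proof.
by apply: measurable_funM => //; apply: measurable_fun_lt_cst; exact: measurable_funX.
Qed.

End truncation.

Section low_deviation.
Context {R : realType} {d : measure_display} {T : measurableType d}.
Context {P : probability T R} {X : nat -> {RV P >-> R}}.
Variable g : R -> R.
Hypothesis hX : iid X.
Hypothesis mg : measurable_fun [set: R] g.
Hypothesis g0 : forall x, 0 <= g x.
Hypothesis g_fin : (\int[P]_w (g (X 0%N w))%:E < +oo)%E.

Let mu := fine (\int[P]_w (g (X 0%N w))%:E)%E.
Let e i := fine (\int[P]_w (low g i (X 0%N w))%:E)%E.

Lemma ge0_integral_comp_le (f h : R -> R) :
  measurable_fun [set: R] f -> measurable_fun [set: R] h ->
  (forall x, 0 <= f x <= h x) ->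
  (\int[P]_w (f (X 0%N w))%:E <= \int[P]_w (h (X 0%N w))%:E)%E.
Proof.
move=> mf mh fh; apply: ge0_le_integral => //.
- by move=> w _; rewrite lee_fin; have /andP[] := fh (X 0%N w).
- by apply/measurable_EFinP; exact: measurableT_comp.
- by apply/measurable_EFinP; exact: measurableT_comp.
- by move=> w _; rewrite lee_fin; have /andP[] := fh (X 0%N w).
Qed.

Lemma dominated_integral_fin_num (f : R -> R) :
  measurable_fun [set: R] f -> (forall x, 0 <= f x <= g x) ->
  (\int[P]_w (f (X 0%N w))%:E)%E \is a fin_num.
Proof.
move=> mf fg; rewrite ge0_fin_numE.
  exact: le_lt_trans (ge0_integral_comp_le mf mg fg) g_fin.
by apply: integral_ge0 => w _; rewrite lee_fin; have /andP[] := fg (X 0%N w).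
Qed.

Let lowg i x : 0 <= low g i x <= g x.
Proof. by rewrite low_ge0// low_le. Qed.

Let mu_fin : (\int[P]_w (g (X 0%N w))%:E)%E \is a fin_num.
Proof. by apply: dominated_integral_fin_num => // x; rewrite g0 lexx. Qed.

Let mu0 : 0 <= mu.
Proof. by apply: fine_ge0; apply: integral_ge0 => w _; rewrite lee_fin. Qed.

Lemma integral_low_high i :
  (\int[P]_w (g (X 0%N w))%:E = \int[P]_w (low g i (X 0%N w))%:E +
    \int[P]_w (high g i (X 0%N w))%:E)%E.
Proof.
rewrite -ge0_integralD//=; last 4 first.
- by move=> v _; rewrite lee_fin low_ge0.
- by apply/measurable_EFinP/measurableT_comp => //; exact: measurable_low.
- by move=> v _; rewrite lee_fin high_ge0.
- by apply/measurable_EFinP/measurableT_comp => //; exact: measurable_high.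
by apply: eq_integral => v _; rewrite -EFinD low_add_high.
Qed.

Lemma low_mean_bounds i : 0 <= e i <= mu.
Proof.
rewrite fine_ge0/=; last first.
  by apply: integral_ge0 => w _; rewrite lee_fin low_ge0.
apply: fine_le => //; last exact: (ge0_integral_comp_le (measurable_low mg i) mg).
exact: (dominated_integral_fin_num (measurable_low mg i)).
Qed.

(** Chebyshev's inequality and Borel-Cantelli at the fifth powers, then
    [interpolate_fifth_powers]. *)
Lemma low_deviation : \forall w \ae P, \forall n \near \oo,
  `|\sum_(1 <= i < n.+1) low g i (X i w) - \sum_(1 <= i < n.+1) e i| <=
  (16 + 31 * mu) * n%:R `^ (4 / 5).
Proof.
pose s m := index_iota 1 (m.+1 ^ 5).+1.
pose bad m := [set w | (m.+1%:R ^+ 4 : R) <=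
  `|\sum_(i <- s m) low g i (X i w) - \sum_(i <- s m) e i|].
have mlow i := measurable_low mg i.
have mbad m : measurable (bad m).
  apply: measurable_ge_cst; apply: measurableT_comp => //.
  by apply: measurable_funB => //; exact: measurable_sum_comp.
have sq i m : (i <= m ^ 5)%N ->
    (\int[P]_w (low g i (X 0%N w) ^+ 2)%:E <= m%:R%:E * mu%:E)%E.
  move=> im; rewrite /mu fineK// -ge0_integralZl_EFin//; last 2 first.
  - by move=> w _; rewrite lee_fin.
  - by apply/measurable_EFinP; exact: measurableT_comp.
  apply: ge0_le_integral => //.
  - by move=> w _; rewrite lee_fin sqr_ge0.
  - by apply/measurable_EFinP; apply: measurable_funX; exact: measurableT_comp.
  - by apply: measurable_funeM; apply/measurable_EFinP; exact: measurableT_comp.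
  - move=> w _; rewrite -EFinM lee_fin expr2.
    by apply: ler_pM; rewrite ?low_ge0 ?low_le// low_root_le.
have Pbad m : (P (bad m) <= (m.+1%:R ^- 2 * mu)%:E)%E.
  have t0 : 0 < m.+1%:R ^+ 4 :> R by rewrite exprn_gt0.
  have lM i x : low g i x <= i%:R.
    apply: low_root_le => //; rewrite -[leqLHS]expn1.
    by case: i => // i; rewrite leq_pexp2l.
  apply: (le_trans (chebyshev_indep_sum (s := s m) hX mlow (low_ge0 g0) lM
    (iota_uniq _ _) t0)).
  apply: (@le_trans _ _ ((m.+1%:R ^+ 4) ^- 2 * ((m.+1 ^ 5)%:R * (m.+1%:R * mu)))%:E).
    rewrite EFinM lee_pmul2l ?lte_fin ?invr_gt0 ?exprn_gt0//.
    have q0 : (0 <= (m.+1%:R * mu)%:E)%E by rewrite lee_fin mulr_ge0.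
    have Hsz : size (s m) = (m.+1 ^ 5)%N by rewrite size_iota subn1.
    have <- : (\sum_(i <- s m) (m.+1%:R * mu)%:E =
        ((m.+1 ^ 5)%:R * (m.+1%:R * mu))%:E)%E.
      by rewrite EFinM -Hsz; exact: ge0_sume_const.
    rewrite big_seq [leRHS]big_seq; apply: lee_sum => i.
    by rewrite mem_index_iota ltnS => /andP[_ im]; rewrite EFinM; exact: sq.
  rewrite lee_fin natrX; set x := m.+1%:R.
  have x0 : x != 0 :> R by rewrite pnatr_eq0.
  by rewrite le_eqVlt; apply/orP; left; apply/eqP; field.
have ev : \forall w \ae P, \forall m \near \oo, ~ bad m w.
  apply: (@borel_cantelli_ae _ _ _ _ _ (2 * mu)) => // n.
  apply: (@le_trans _ _ (\sum_(0 <= k < n) (k.+1%:R ^- 2 * mu)%:E)%E).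
    exact: lee_sum.
  by rewrite sumEFin lee_fin -mulr_suml ler_wpM2r// sum_inv_sqr_le.
apply: filterS ev => w [N _ HN].
exists (N.+1 ^ 5)%N => // n /= Nn.
apply: (interpolate_fifth_powers (N := N) _ low_mean_bounds) => // [i|m Nm].
  exact: low_ge0.
by have := HN m Nm; rewrite /bad/= => /negP; rewrite -ltNge => /ltW.
Qed.

(** The low parts account for the n^(4/5) term; the high parts are left to be
    estimated according to the moment that is available. *)
Lemma truncation_deviation : \forall w \ae P, \forall n \near \oo,
  `|\sum_(1 <= i < n.+1) g (X i w) - n%:R * mu| <=
  (16 + 31 * mu) * n%:R `^ (4 / 5) + \sum_(1 <= i < n.+1) high g i (X i w)
  + \sum_(1 <= i < n.+1) fine (\int[P]_w (high g i (X 0%N w))%:E)%E.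
Proof.
apply: filterS low_deviation => w; apply: filterS => n.
have highg i x : 0 <= high g i x <= g x by rewrite high_ge0// high_le.
have -> : n%:R * mu = \sum_(1 <= i < n.+1) e i +
    \sum_(1 <= i < n.+1) fine (\int[P]_w (high g i (X 0%N w))%:E)%E.
  rewrite -big_split/=.
  have -> : n%:R * mu = \sum_(1 <= i < n.+1) mu.
    by rewrite sumr_const_nat subn1 mulr_natl.
  apply: eq_bigr => i _; rewrite /e -fineD -?integral_low_high//.
  - exact: (dominated_integral_fin_num (measurable_low mg i)).
  - exact: (dominated_integral_fin_num (measurable_high mg i)).
have -> : \sum_(1 <= i < n.+1) g (X i w) = \sum_(1 <= i < n.+1) low g i (X i w) +
    \sum_(1 <= i < n.+1) high g i (X i w).
  by rewrite -big_split/=; apply: eq_bigr => i _; rewrite low_add_high.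
have h1 : 0 <= \sum_(1 <= i < n.+1) high g i (X i w).
  by apply: sumr_ge0 => i _; exact: high_ge0.
have h2 : 0 <= \sum_(1 <= i < n.+1) fine (\int[P]_w (high g i (X 0%N w))%:E)%E.
  apply: sumr_ge0 => i _; apply: fine_ge0; apply: integral_ge0 => v _.
  by rewrite lee_fin high_ge0.
move=> /ler_normlP[H1 H2]; apply/ler_normlP; split; lra.
Qed.

End low_deviation.

(** * Powers of log n *)

Section logpow.
Context {R : realType}.

(** This is (log n)^b for n >= 2; the exponential form is positive for all n and
    multiplicative in b without side conditions. *)
Definition logpow (b : R) (n : nat) : R := expR (b * ln (ln n%:R)).

Lemma logpow_gt0 b n : 0 < logpow b n. Proof. exact: expR_gt0. Qed.

Lemma logpow_ge0 b n : 0 <= logpow b n. Proof. exact: expR_ge0. Qed.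

Lemma logpowD b c n : logpow (b + c) n = logpow b n * logpow c n.
Proof. by rewrite /logpow mulrDl expRD. Qed.

Lemma ln_nat_near (A : R) : \forall n \near \oo, A <= ln (n%:R : R).
Proof.
near=> n; have An : expR A <= n%:R by near: n; exact: nbhs_infty_ger.
by rewrite -[A]expRK ler_ln// posrE ?expR_gt0// (lt_le_trans (expR_gt0 A)).
Unshelve. all: by end_near. Qed.

Lemma lnln_nat_near (A : R) : \forall n \near \oo, A <= ln (ln (n%:R : R)).
Proof.
near=> n; have An : expR A <= ln (n%:R : R) by near: n; exact: ln_nat_near.
by rewrite -[A]expRK ler_ln// posrE ?expR_gt0// (lt_le_trans (expR_gt0 A)).
Unshelve. all: by end_near. Qed.

Lemma logpow_le b c n : 0 <= ln (ln (n%:R : R)) -> b <= c -> logpow b n <= logpow c n.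
Proof. by move=> l0 bc; rewrite ler_expR ler_wpM2r. Qed.

(** Raising the exponent absorbs constants, because loglog n tends to infinity. *)
Lemma logpow_absorb (C b c : R) : b < c ->
  \forall n \near \oo, C * logpow b n <= logpow c n.
Proof.
move=> bc; near=> n.
have -> : c = (c - b) + b by rewrite subrK.
rewrite logpowD ler_wpM2r ?logpow_ge0//; apply: le_trans (expR_ge1Dx _).
have : C / (c - b) <= ln (ln (n%:R : R)) by near: n; exact: lnln_nat_near.
by rewrite ler_pdivrMr ?subr_gt0//; move: (ln _) => x; lra.
Unshelve. all: by end_near. Qed.

(** With l = log n and x = log l the claim is C e^(4l/5) <= e^(l + b x), true
    eventually since l = e^x grows faster than any multiple of x. *)
Lemma root_absorb (C b : R) :
  \forall n \near \oo, C * n%:R `^ (4 / 5) <= n%:R * logpow b n.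
Proof.
near=> n.
have n0 : (0 < n)%N by near: n; exact: nbhs_infty_gt.
have n0R : 0 < n%:R :> R by rewrite ltr0n.
have l1 : 1 <= ln (n%:R : R) by near: n; exact: ln_nat_near.
have x0 : 0 <= ln (ln (n%:R : R)) by near: n; exact: lnln_nat_near.
have xC : C <= ln (ln (n%:R : R)) by near: n; exact: lnln_nat_near.
have xb : 20 * (`|b| + 1) <= ln (ln (n%:R : R)).
  by near: n; exact: lnln_nat_near.
rewrite /powR gt_eqF// -[X in X * logpow b n](@lnK R)//.
rewrite /logpow; move: l1 x0 xC xb; set l := ln n%:R; set x := ln l => l1 x0 xC xb.
rewrite -expRD; have l0 : 0 < l by exact: lt_le_trans l1.
have lx : x ^+ 2 / 4 <= l.
  have -> : l = expR (x / 2) ^+ 2.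
    by rewrite expr2 -expRD -splitr lnK// posrE.
  have := expR_ge1Dx (x / 2); set y := expR _ => y1; nra.
have eC : C <= expR x by apply: (le_trans xC); have := expR_ge1Dx x; lra.
apply: (@le_trans _ _ (expR x * expR (4 / 5 * l))).
  by rewrite ler_wpM2r// expR_ge0.
rewrite -expRD ler_expR.
have : - `|b| <= b by rewrite lerNl -normrN ler_norm.
have : 0 <= `|b| by [].
move: (`|b|) xb => B xb B0 Bb.
have : (B + 1) * x <= l / 5 by nra.
nra.
Unshelve. all: by end_near. Qed.

Lemma powR_inv_le_expR (y b t : R) : 0 <= y -> 0 < t ->
  (y `^ t^-1 <= expR b) = (y <= expR (b * t)).
Proof.
move=> y0 t0.
have ti : 0 <= t^-1 by rewrite invr_ge0 ltW.
have eb : expR b = expR (b * t) `^ t^-1.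
  by rewrite -expRM mulfK// gt_eqF.
apply/idP/idP => h; last by rewrite eb ge0_ler_powR// nnegrE// expR_ge0.
rewrite -[y]powRr1// -(mulVf (negbT (gt_eqF t0))) powRrM expRM.
by rewrite ge0_ler_powR// ?nnegrE ?powR_ge0 ?expR_ge0// ltW.
Qed.

End logpow.

(** * The weights x / (Lx)^b *)

Section Llog.
Context {R : realType}.
Implicit Types (b x y : R).

Lemma Llog_ge1 x : 1 <= Llog x.
Proof.
rewrite /Llog -[leLHS]expRK ler_ln// ?posrE ?expR_gt0// ?le_max ?lexx//.
by rewrite lt_max expR_gt0.
Qed.

Lemma Llog_gt0 x : 0 < Llog x. Proof. exact: lt_le_trans (Llog_ge1 x). Qed.

Lemma Llog_le x y : x <= y -> Llog x <= Llog y.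
Proof.
move=> xy; rewrite /Llog ler_ln ?posrE ?lt_max ?expR_gt0//.
by rewrite ge_max !le_max lexx /= xy orbT.
Qed.

Lemma ln_le_Llog x : 0 < x -> ln x <= Llog x.
Proof.
move=> x0; rewrite /Llog ler_ln ?posrE ?lt_max ?x0 ?orbT//.
by rewrite le_max lexx orbT.
Qed.

Lemma Llog_powR_gt0 x b : 0 < Llog x `^ b.
Proof. by rewrite powR_gt0// Llog_gt0. Qed.

Lemma ln_ge1_nat_gt0 (n : nat) : 1 <= ln (n%:R : R) -> 0 < n%:R :> R.
Proof. by case: n => [|n]; rewrite ?ltr0n// ln0//; lra. Qed.

Lemma Llog_nat (n : nat) : 1 <= ln (n%:R : R) -> Llog (n%:R : R) = ln n%:R.
Proof.
move=> n1; rewrite /Llog; congr ln; apply/max_idPr.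
have n0 : 0 < n%:R :> R.
  exact: ln_ge1_nat_gt0.
by rewrite -[leRHS]lnK ?posrE// ler_expR.
Qed.

Lemma logpow_nat_powR b (n : nat) : 1 <= ln (n%:R : R) ->
  logpow b n = ln (n%:R : R) `^ b.
Proof. by move=> n1; rewrite /logpow /powR gt_eqF//; apply: lt_le_trans n1. Qed.

(** The function whose expectation at |X| defines [moment_exponent]. *)
Definition logweight b x : R := x / Llog x `^ b.

Lemma logweight_ge0 b x : 0 <= x -> 0 <= logweight b x.
Proof. by move=> x0; rewrite divr_ge0// powR_ge0. Qed.

Lemma logweight_le b c x : 0 <= x -> b <= c -> logweight c x <= logweight b x.
Proof.
move=> x0 bc; rewrite ler_wpM2l// lef_pV2 ?posrE ?Llog_powR_gt0//.
by rewrite ler_powR// Llog_ge1.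
Qed.

Lemma logweight0 x : logweight 0 x = x.
Proof. by rewrite /logweight powRr0 divr1. Qed.

Lemma measurable_Llog : measurable_fun [set: R] (@Llog R).
Proof.
apply: (measurableT_comp (f := @ln R)); first exact: measurable_ln.
by apply: measurable_maxr.
Qed.

Lemma measurable_Llog_powR b : measurable_fun [set: R] (fun x => Llog x `^ b).
Proof. exact: (measurableT_comp (measurable_powR b) measurable_Llog). Qed.

Lemma measurable_logweight b : measurable_fun [set: R] (logweight b).
Proof.
rewrite (_ : logweight b = fun x => x * Llog x `^ (- b)).
  by apply: measurable_funM => //; exact: measurable_Llog_powR.
by apply/funext => x; rewrite /logweight powRN.
Qed.

(** For b >= 0 the hypothesis forces x >= n, so Lx >= log n. For b < 0 either
    x >= n, which is more than enough, or Lx <= log n. *)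
Lemma logweight_gt_nat b x (n : nat) : 1 <= ln (n%:R : R) -> 0 <= x ->
  n%:R < logweight b x -> n%:R * logpow b n <= x.
Proof.
move=> n1 x0; rewrite /logweight ltr_pdivlMr ?Llog_powR_gt0// => nx.
rewrite logpow_nat_powR//.
have n0 : 0 <= n%:R :> R by [].
have nL : n%:R <= x -> ln (n%:R : R) <= Llog x.
  by rewrite -Llog_nat//; exact: Llog_le.
have Ln : x <= n%:R -> Llog x <= ln (n%:R : R).
  by rewrite -(Llog_nat n1); exact: Llog_le.
have l0 : 0 <= ln (n%:R : R) by apply: le_trans n1.
have [b0|b0] := leP 0 b.
  apply: le_trans (ltW nx); rewrite ler_wpM2l// ge0_ler_powR// ?nnegrE//.
    exact: ltW (Llog_gt0 _).
  apply: nL; apply: le_trans (ltW nx); rewrite ler_peMr//.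
  by rewrite -(powRr0 (Llog x)) ler_powR// Llog_ge1.
have [xn|xn] := leP n%:R x.
  apply: le_trans xn; rewrite ler_piMr// -[leRHS](powRr0 (ln (n%:R : R))).
  by rewrite ler_powR// ltW.
apply: le_trans (ltW nx); rewrite ler_wpM2l// -(opprK b) 2!(powRN _ (- b)).
rewrite lef_pV2 ?posrE ?powR_gt0 ?Llog_gt0 ?(lt_le_trans ltr01 n1)//.
rewrite ge0_ler_powR ?nnegrE ?oppr_ge0 ?(ltW b0)//.
  exact: ltW (Llog_gt0 _).
by apply: Ln; exact: ltW.
Qed.

End Llog.

(** * Growth exponents of partial sums and the effect of one large term *)

Section growth.
Context {R : realType}.
Implicit Types (x z h : nat -> R).

Definition psum x n : R := \sum_(1 <= i < n.+1) x i.

(** Equivalent to a bound e^b on the normed mean, see [normed_mean_growth]. *)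
Definition growth_le x (b : R) : Prop :=
  \forall n \near \oo, `|psum x n| <= n%:R * logpow b n.

Lemma growth_leW x (b c : R) : b <= c -> growth_le x b -> growth_le x c.
Proof.
move=> bc; rewrite /growth_le => H; near=> n.
have Hn : `|psum x n| <= n%:R * logpow b n by near: n.
apply: (le_trans Hn); rewrite ler_wpM2l// logpow_le//.
by near: n; exact: lnln_nat_near.
Unshelve. all: by end_near. Qed.

(** loglog varies by at most log 2 between n - 1 and n, since n <= (n - 1)^2. *)
Lemma logpow_pred_le (b : R) (n : nat) : (3 <= n)%N -> 1 <= ln (n.-1%:R : R) ->
  logpow b n.-1 <= expR (`|b| * ln 2) * logpow b n.
Proof.
move=> n3 l1; case: n n3 l1 => // n; rewrite /= ltnS => n2 l1.
have n0N : (0 < n)%N by lia.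
have n0 : 0 < n%:R :> R by rewrite ltr0n.
have nn : n%:R <= n.+1%:R :> R by rewrite ler_nat.
have l2 : ln (n%:R : R) <= ln n.+1%:R by rewrite ler_ln ?posrE// ltr0n.
have l3 : ln (n.+1%:R : R) <= 2 * ln n%:R.
  rewrite mulr_natl mulr2n -lnM ?posrE// ler_ln ?posrE ?mulr_gt0 ?ltr0n//.
  by rewrite -natrM ler_nat; nia.
have l0 : 0 < ln (n%:R : R) by apply: lt_le_trans l1.
have m1 : ln (ln (n%:R : R)) <= ln (ln n.+1%:R).
  by rewrite ler_ln ?posrE ?(lt_le_trans l0 l2).
have m2 : ln (ln (n.+1%:R : R)) <= ln 2 + ln (ln n%:R).
  by rewrite -lnM ?posrE// ler_ln ?posrE ?mulr_gt0 ?(lt_le_trans l0 l2).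
rewrite /logpow -expRD ler_expR.
move: m1 m2; set u := ln (ln _); set v := ln (ln _); set t := ln 2 => m1 m2.
have : `|b * (u - v)| <= `|b| * t.
  by rewrite normrM ler_wpM2l// ler_norml; lra.
by rewrite ler_norml => /andP[_]; lra.
Qed.

(** x n is the difference of two consecutive partial sums, so bounds
    n (log n)^b on the latter would bound x n by a constant times n (log n)^b. *)
Lemma large_term_growth x (b c : R) : b < c ->
  (forall N, exists2 n, (N <= n)%N & n%:R * logpow c n <= `|x n|) ->
  ~ growth_le x b.
Proof.
move=> bc H [N0 _ HN0].
pose K := expR (`|b| * ln 2) : R.
have K0 : 0 < K by exact: expR_gt0.
have [N1 _ HN1] : \forall n \near \oo, (2 + K) * logpow b n <= logpow c n.
  exact: logpow_absorb.
have [N2 _ HN2] := @ln_nat_near R 1.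
have [n Nn xn] := H (N0 + N1 + N2 + 3)%N.
have n3 : (3 <= n)%N by lia.
have H1 : `|psum x n| <= n%:R * logpow b n by apply: HN0 => /=; lia.
have H2 : `|psum x n.-1| <= n.-1%:R * logpow b n.-1 by apply: HN0 => /=; lia.
have H3 : (2 + K) * logpow b n <= logpow c n by apply: HN1 => /=; lia.
have H4 : logpow b n.-1 <= K * logpow b n.
  by apply: logpow_pred_le => //; apply: HN2 => /=; lia.
have xE : x n = psum x n - psum x n.-1.
  case: n n3 {Nn xn H1 H2 H3 H4} => // n _.
  by rewrite /psum /= [in RHS]big_nat_recr//= addrAC subrr add0r.
have xle : `|x n| <= n%:R * logpow b n + n%:R * (K * logpow b n).
  rewrite xE (le_trans (ler_normB _ _))// lerD// (le_trans H2)//.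
  by rewrite ler_pM ?logpow_ge0// ler_nat leq_pred.
have n0 : 0 < n%:R :> R by rewrite ltr0n; lia.
have := le_trans xn xle; have := logpow_gt0 b n.
have : n%:R * ((2 + K) * logpow b n) <= n%:R * logpow c n by rewrite ler_wpM2l// ltW.
move: (logpow b n) (logpow c n) (n%:R) n0 => p q r r0; nra.
Qed.

(** Taking logarithms in y <= K n (Ly)^b gives u <= log (K n) + b log u for
    u = Ly = log y, and log u grows more slowly than u / (2 b + 2). *)
Lemma Llog_le_of_logweight (b K : R) : 0 <= b -> 1 <= K -> exists2 D : R, 0 < D &
  forall (n : nat) (y : R), 1 <= ln (n%:R : R) -> 0 <= y ->
    logweight b y <= K * n%:R -> Llog y <= D * ln n%:R.
Proof.
move=> b0 K1; pose a := (2 * (b + 1))^-1.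
have a0 : 0 < a by rewrite invr_gt0; lra.
exists (1 + 2 * ln K + 2 + 2 * b * `|ln a|).
  have lK := ln_ge0 K1.
  have bla : 0 <= b * `|ln a| by rewrite mulr_ge0.
  lra.
move=> n y n1 y0 yK.
have lK := ln_ge0 K1.
have bla : 0 <= b * `|ln a| by rewrite mulr_ge0.
have n0 : 0 < n%:R :> R.
  exact: ln_ge1_nat_gt0.
have [ye|ye] := leP y (expR 1).
  have -> : Llog y = 1 by rewrite /Llog; move/max_idPl: ye => ->; rewrite expRK.
  nra.
have y1 : 0 < y by rewrite (lt_trans (expR_gt0 1)).
have Ly : Llog y = ln y by rewrite /Llog; move/ltW/max_idPr: ye => ->.
have L1 := Llog_ge1 y; have L0 := Llog_gt0 y.
have : y <= K * n%:R * Llog y `^ b.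
  by move: yK; rewrite /logweight ler_pdivrMr// Llog_powR_gt0.
rewrite -ler_ln ?posrE ?mulr_gt0 ?Llog_powR_gt0//; last by lra.
rewrite !lnM ?posrE ?mulr_gt0 ?Llog_powR_gt0//; [|lra..].
rewrite ln_powR -Ly.
have : ln (a * Llog y) < a * Llog y by apply: ln_sublinear; rewrite mulr_gt0.
rewrite lnM ?posrE// => h1.
(* Since log (a u) < a u, the concave term is bounded by
   b log u <= b |log a| + a b u, and a was chosen so that a b <= 1/2. *)
have h2 : - ln a <= `|ln a| by rewrite -normrN ler_norm.
have ba : b * a <= 2^-1 by rewrite /a ler_pdivrMr; lra.
have h3 : b * (a * Llog y) <= Llog y / 2.
  by rewrite mulrA [leRHS]mulrC ler_wpM2r// ltW.
have h4 : b * ln (Llog y) <= b * (`|ln a| + a * Llog y) by rewrite ler_wpM2l//; lra.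
move: n1; move: (ln n%:R) (ln K) (`|ln a|) lK bla h4 h3 => l k A *.
nra.
Qed.

End growth.

(** * Pathwise growth of weighted sums *)

Section deterministic.
Context {R : realType}.
Implicit Types (x z h : nat -> R).

(** Each weight is at most the whole sum K n, so L|x i| = O(log n) uniformly in
    i <= n; this bounds |x i| by its weight times a constant times (log n)^b. *)
Lemma growth_le_of_logweight x (b c K : R) : 0 <= b -> b < c ->
  (\forall n \near \oo,
     \sum_(1 <= i < n.+1) logweight b `|x i| <= K * n%:R) ->
  growth_le x c.
Proof.
move=> b0 bc H; pose K' := Num.max K 1.
have K'1 : 1 <= K' by rewrite /K' le_max lexx orbT.
have [D D0 HD] := Llog_le_of_logweight b0 K'1.
rewrite /growth_le; near=> n.
have n1 : 1 <= ln (n%:R : R) by near: n; exact: ln_nat_near.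
have n0 := ln_ge1_nat_gt0 n1.
have H1 : \sum_(1 <= i < n.+1) logweight b `|x i| <= K' * n%:R.
  have Hn : \sum_(1 <= i < n.+1) logweight b `|x i| <= K * n%:R by near: n.
  by apply: (le_trans Hn); rewrite ler_wpM2r// le_max lexx.
have absorb : (D `^ b * K') * logpow b n <= logpow c n.
  by near: n; exact: logpow_absorb.
apply: (@le_trans _ _ (\sum_(1 <= i < n.+1) logweight b `|x i| * (D `^ b * logpow b n))).
  apply: (le_trans (ler_norm_sum _ _ _)).
  rewrite big_seq [leRHS]big_seq; apply: ler_sum => i.
  rewrite mem_index_iota => /andP[i1 iltn].
  have Li : Llog `|x i| <= D * ln n%:R.
    apply: HD => //; apply: le_trans H1.
    rewrite (bigD1_seq i) ?mem_index_iota ?i1 ?iota_uniq//= lerDl.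
    by apply: sumr_ge0 => j _; exact: logweight_ge0.
  have -> : D `^ b * logpow b n = (D * ln n%:R) `^ b.
    by rewrite powRM ?(ltW D0) ?(le_trans _ n1)// logpow_nat_powR.
  rewrite -[leLHS](@divfK _ (Llog `|x i| `^ b)) ?gt_eqF ?Llog_powR_gt0//.
  rewrite ler_wpM2l ?logweight_ge0// ge0_ler_powR// ?nnegrE.
    exact: ltW (Llog_gt0 _).
  by rewrite mulr_ge0 ?(ltW D0) ?(le_trans _ n1).
rewrite -mulr_suml; apply: (@le_trans _ _ (K' * n%:R * (D `^ b * logpow b n))).
  by rewrite ler_wpM2r// mulr_ge0 ?powR_ge0 ?logpow_ge0.
have -> : K' * n%:R * (D `^ b * logpow b n) = n%:R * (D `^ b * K' * logpow b n) by ring.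
by rewrite ler_wpM2l// ltW.
Unshelve. all: by end_near. Qed.

(** Indices i <= sqrt n contribute O(sqrt n), which is negligible; for the others
    log i >= (log n) / 2, so that (log i)^(-c) is comparable to (log n)^(-c).
    It is applied both to a sample path and to the sequence of means. *)
Lemma weighted_sum_growth z h (c B K : R) : 0 <= c -> 0 <= B -> 0 <= K ->
  (forall i, 0 <= h i <= z i) ->
  (forall i, 1 <= ln (i%:R : R) -> h i * logpow c i <= B * z i) ->
  (\forall n \near \oo, \sum_(1 <= i < n.+1) z i <= K * n%:R) ->
  \forall n \near \oo, \sum_(1 <= i < n.+1) h i <=
     (1 + B * expR (c * ln 2) * K) * (n%:R * logpow (- c) n).
Proof.
move=> c0 B0 K0 hz hB [N1 _ HN1].
have [N2 _ HN2] := @ln_nat_near R 1.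
have h0 i : 0 <= h i by have /andP[] := hz i.
have hlez i : h i <= z i by have /andP[] := hz i.
have z0 i : 0 <= z i by apply: le_trans (hlez i).
near=> n.
have nN : ((N1 + N2 + 2) ^ 2 <= n)%N by near: n; exact: nbhs_infty_ge.
have small : K * n%:R `^ (4 / 5) <= n%:R * logpow (- c) n.
  by near: n; exact: root_absorb.
have [s /andP[sn ns]] := @nat_root_floor 2 n isT.
have Ns : (N1 + N2 + 2 <= s)%N.
  by rewrite -ltnS -(ltn_exp2r _ _ (isT : (0 < 2)%N)) (leq_ltn_trans nN).
have sln : (s <= n)%N by apply: leq_trans sn; rewrite -[leqLHS]expn1 leq_exp2l//; lia.
rewrite (@big_cat_nat _ _ _ s.+1)//= mulrDl mul1r lerD//.
  apply: le_trans small.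
  apply: (@le_trans _ _ (K * s%:R)).
    apply: (@le_trans _ _ (\sum_(1 <= i < s.+1) z i)); first exact: ler_sum.
    by apply: HN1 => /=; lia.
  rewrite ler_wpM2l//.
  have s1 : 1 <= s%:R :> R by rewrite ler1n; lia.
  have n1 : 1 <= n%:R :> R by rewrite ler1n; lia.
  apply: (@le_trans _ _ (n%:R `^ 2^-1)); last first.
    by rewrite ler_powR//; lra.
  rewrite -[leLHS]powRr1// -[X in _ `^ X](divff (_ : 2 != 0 :> R))// powRrM.
  by rewrite ge0_ler_powR ?nnegrE// powR_mulrn// -natrX ler_nat.
set E := expR (c * ln 2).
apply: (@le_trans _ _ (\sum_(s.+1 <= i < n.+1) (B * E * logpow (- c) n) * z i)).
  rewrite big_seq [leRHS]big_seq; apply: ler_sum => i.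
  rewrite mem_index_iota => /andP[si iltn].
  have i1 : 1 <= ln (i%:R : R) by apply: HN2 => /=; lia.
  have i0 := ln_ge1_nat_gt0 i1.
  have n0 : 0 < n%:R :> R by rewrite ltr0n; lia.
  have n1 : 1 <= ln (n%:R : R) by apply: HN2 => /=; lia.
  have l1 : ln (n%:R : R) <= 2 * ln i%:R.
    rewrite mulr_natl mulr2n -lnM ?posrE// ler_ln ?posrE ?mulr_gt0//.
    by rewrite -natrM ler_nat; nia.
  have l2 : ln (ln (n%:R : R)) <= ln 2 + ln (ln i%:R).
    rewrite -lnM ?posrE ?(lt_le_trans ltr01 i1)//.
    by rewrite ler_ln ?posrE ?mulr_gt0 ?(lt_le_trans ltr01 i1) ?(lt_le_trans ltr01 n1).
  have l3 : logpow (- c) i <= E * logpow (- c) n.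
    rewrite /logpow /E -expRD ler_expR.
    have := ler_wpM2l c0 l2; lra.
  have hi := hB _ i1.
  have -> : h i = (h i * logpow c i) * logpow (- c) i.
    by rewrite -mulrA -logpowD subrr /logpow mul0r expR0 mulr1.
  apply: (@le_trans _ _ (B * z i * logpow (- c) i)).
    by rewrite ler_wpM2r// logpow_ge0.
  have -> : B * E * logpow (- c) n * z i = B * z i * (E * logpow (- c) n) by ring.
  by rewrite ler_wpM2l// mulr_ge0.
rewrite -mulr_sumr.
apply: (@le_trans _ _ (B * E * logpow (- c) n * (K * n%:R))); last first.
  by rewrite le_eqVlt; apply/orP; left; apply/eqP; ring.
rewrite ler_wpM2l ?mulr_ge0 ?expR_ge0 ?logpow_ge0//.
apply: (@le_trans _ _ (\sum_(1 <= i < n.+1) z i)); last by apply: HN1 => /=; nia.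
rewrite [leRHS](@big_cat_nat _ _ _ s.+1)//= lerDr; exact: sumr_ge0.
Unshelve. all: by end_near. Qed.

End deterministic.

(** * The second Borel-Cantelli lemma and infinite moments *)

Section borel_cantelli2.
Context {R : realType} {d : measure_display} {T : measurableType d}.
Context {P : probability T R} {X : nat -> {RV P >-> R}}.
Hypothesis hX : iid X.

(** Independence and 1 - p <= e^(-p). *)
Lemma indep_avoid_le (B : nat -> set R) (N M : nat) :
  (forall k, measurable (B k)) ->
  (P (\bigcap_(i in [set` iota N M]) (X i @^-1` ~` B i)) <=
   (expR (- \sum_(i <- iota N M) fine (P (X i @^-1` B i))))%:E)%E.
Proof.
move=> mB.
rewrite (hX.1 (iota N M) (fun i => ~` B i)) ?iota_uniq//; last first.
  by move=> i; exact: measurableC.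
have mXB i : measurable (X i @^-1` B i).
  by rewrite -[X in measurable X]setTI; exact: (measurable_funPT (X i)).
elim: (iota N M) => [|i s IH]; first by rewrite !big_nil oppr0 expR0.
rewrite !big_cons opprD expRD EFinM; apply: lee_pmul => //.
  by apply: prode_ge0 => j _; exact: measure_ge0.
have -> : X i @^-1` (~` B i) = ~` (X i @^-1` B i) by [].
rewrite probability_setC//; have Pf := fin_num_measure P _ (mXB i).
rewrite -[in leLHS](fineK Pf) -EFinB lee_fin.
by apply: le_trans (expR_ge1Dx _).
Qed.

(** If none of the events after N occurred with positive probability a, then
    [indep_avoid_le] would bound all the partial sums by N - log a. *)
Lemma borel_cantelli2 (B : nat -> set R) :
  (forall k, measurable (B k)) ->
  (\sum_(0 <= k <oo) P (X k @^-1` B k) = +oo)%E ->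
  \forall w \ae P, forall N, exists2 k, (N <= k)%N & B k (X k w).
Proof.
move=> mB Soo; apply: ae_foralln => N.
have mXB i : measurable (X i @^-1` B i).
  by rewrite -[X in measurable X]setTI; exact: (measurable_funPT (X i)).
pose A := \bigcap_(k in [set k | (N <= k)%N]) (X k @^-1` ~` B k).
have mA : measurable A.
  apply: bigcap_measurable => [|k _]; first by exists N; rewrite /= leqnn.
  exact: (measurableC (mXB k)).
exists A; split => //; last first.
  by move=> w /= H k Nk Bk; apply: H; exists k.
apply/eqP; rewrite eq_le measure_ge0 andbT leNgt; apply/negP => PA0.
have PAf := fin_num_measure P _ mA.
have a0 : 0 < fine (P A) by rewrite fine_gt0// PA0 ltey_eq PAf.
have bound M : \sum_(i <- iota N M) fine (P (X i @^-1` B i)) <= - ln (fine (P A)).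
  rewrite lerNr -[leRHS]expRK ler_ln ?posrE ?expR_gt0//.
  rewrite -lee_fin fineK//; apply: le_trans (indep_avoid_le N M mB).
  apply: le_measure; rewrite ?inE//.
    apply: fin_bigcap_measurable => [|i _]; first exact: finite_seq.
    exact: (measurableC (mXB i)).
  move=> w Aw i /=; rewrite mem_iota => /andP[Ni _]; exact: Aw.
have : (\sum_(0 <= k <oo) P (X k @^-1` B k) <= (N%:R - ln (fine (P A)))%:E)%E.
  apply: lime_le; first exact: is_cvg_nneseries.
  apply: nearW => n.
  apply: (@le_trans _ _ (\sum_(0 <= k < N + n) P (X k @^-1` B k))%E).
    apply: (@lee_sum_nneg_natr _ (fun k => P (X k @^-1` B k)) xpredT 0) => //.
    by rewrite leq_addl.
  rewrite (@big_cat_nat _ _ _ N)//= ?leq_addr// EFinB -EFinN; apply: leeD.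
    apply: (@le_trans _ _ (\sum_(0 <= k < N) 1%E)%E).
      by apply: lee_sum => k _; exact: probability_le1.
    by rewrite ge0_sume_const// size_iota subn0 mule1.
  rewrite /index_iota addKn (eq_bigr (fun k => (fine (P (X k @^-1` B k)))%:E)).
    by rewrite sumEFin lee_fin.
  by move=> k _; rewrite fineK// fin_num_measure.
by rewrite Soo.
Qed.

Lemma min_le_sum_lt (y : R) (n : nat) : 0 <= y ->
  Num.min y n%:R <= \sum_(0 <= k < n) (k%:R < y)%R%:R.
Proof.
move=> y0; elim: n => [|n IH]; first by rewrite big_nil ge_min lexx orbT.
rewrite big_nat_recr//=; case: (ltP n%:R y) => ny /=.
  move: IH; rewrite (min_idPr (ltW ny)) => IH.
  by rewrite ge_min; apply/orP; right; rewrite -[n.+1%:R]natr1; exact: lerD IH (lexx _).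
by move: IH; rewrite (min_idPl ny) addr0; apply: le_trans; rewrite ge_min lexx.
Qed.

(** A nonnegative number is at most the number of naturals strictly below it. *)
Lemma sum_probability_gt_eq_pinfty (g : R -> R) :
  measurable_fun [set: R] g -> (forall x, 0 <= g x) ->
  (\int[P]_w (g (X 0%N w))%:E = +oo)%E ->
  (\sum_(0 <= k <oo) P (X k @^-1` [set x | (k%:R < g x)%R]) = +oo)%E.
Proof.
move=> mg g0 goo; apply/eqP; rewrite -leye_eq -goo.
have mgX : measurable_fun [set: T] (fun w => g (X 0%N w)).
  exact: measurableT_comp.
have mlt k : measurable_fun [set: T] (fun w => ((k%:R < g (X 0%N w))%R%:R : R)%:E).
  by apply/measurable_EFinP; exact: measurable_fun_lt_cst.
under eq_eseriesr => k _ do rewrite (probability_gt_integral hX mg).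
rewrite -integral_nneseries//.
apply: ge0_le_integral => //.
- by move=> w _; rewrite lee_fin.
- exact/measurable_EFinP.
- by apply: ge0_emeasurable_sum => // k w _ _; rewrite lee_fin.
- move=> w _; pose n := Num.bound (g (X 0%N w)).
  apply: (@le_trans _ _ (\sum_(0 <= k < n) ((k%:R < g (X 0%N w))%R%:R : R)%:E)%E).
    rewrite sumEFin lee_fin; apply: le_trans (min_le_sum_lt n (g0 _)).
    by rewrite le_min lexx/= ltW// archi_boundP.
  by apply: nneseries_lim_ge => k _ _; rewrite lee_fin.
Qed.

(** Borel-Cantelli turns the divergence into infinitely many large terms, and a
    large term prevents the partial sums from being small. *)
Lemma infinite_moment_no_growth (b c : R) :
  ~ (\int[P]_w (logweight b `|X 0%N w|)%:E < +oo)%E -> c < b ->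
  \forall w \ae P, ~ growth_le (fun i => X i w) c.
Proof.
move=> Eoo cb.
pose g (x : R) : R := logweight b `|x|.
have mg : measurable_fun [set: R] g.
  apply: measurableT_comp => //; exact: measurable_logweight.
have g0 x : 0 <= g x by exact: logweight_ge0.
have goo : (\int[P]_w (g (X 0%N w))%:E = +oo)%E.
  by apply/eqP; rewrite -leye_eq leNgt; apply/negP.
have mB k : measurable [set x | k%:R < g x] by exact: measurable_gt_cst.
have := borel_cantelli2 mB (sum_probability_gt_eq_pinfty mg g0 goo).
apply: filterS => w H; apply: (large_term_growth cb) => N.
have [N1 _ HN1] := @ln_nat_near R 1.
have [k Nk /= gk] := H (N + N1)%N.
exists k; first by lia.
by apply: logweight_gt_nat => //; apply: HN1 => /=; lia.
Qed.

End borel_cantelli2.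

(** * Almost sure growth for nonnegative summands *)

Section rates.
Context {R : realType} {d : measure_display} {T : measurableType d}.
Context {P : probability T R} {X : nat -> {RV P >-> R}}.
Hypothesis hX : iid X.

(** The weights are integrable, so [sum_le_linear] bounds their sums by a multiple
    of n; the rest is pathwise. *)
Lemma finite_moment_growth (b c : R) : 0 <= b -> b < c ->
  (\int[P]_w (logweight b `|X 0%N w|)%:E < +oo)%E ->
  \forall w \ae P, growth_le (fun i => X i w) c.
Proof.
move=> b0 bc foo.
pose g (x : R) : R := logweight b `|x|.
have mg : measurable_fun [set: R] g.
  by apply: measurableT_comp => //; exact: measurable_logweight.
have g0 x : 0 <= g x by exact: logweight_ge0.
have gfin : (\int[P]_w (g (X 0%N w))%:E)%E \is a fin_num.
  by rewrite ge0_fin_numE// integral_ge0// => w _; rewrite lee_fin.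
have gK : (\int[P]_w (g (X 0%N w))%:E <
    (fine (\int[P]_w (g (X 0%N w))%:E)%E + 1)%:E)%E.
  by rewrite -[ltLHS]fineK// lte_fin ltrDl.
have := sum_le_linear hX mg g0 gK.
apply: filterS => w; exact: growth_le_of_logweight b0 bc.
Qed.

Lemma fine_integral_le (f h : R -> R) (C : R) :
  measurable_fun [set: R] f -> measurable_fun [set: R] h ->
  (forall x, 0 <= f x) -> (forall x, 0 <= h x) -> 0 <= C ->
  (forall x, f x <= C * h x) ->
  (\int[P]_w (h (X 0%N w))%:E < +oo)%E ->
  fine (\int[P]_w (f (X 0%N w))%:E)%E <= C * fine (\int[P]_w (h (X 0%N w))%:E)%E.
Proof.
move=> mf mh f0 h0 C0 fCh hoo.
have hfin : (\int[P]_w (h (X 0%N w))%:E)%E \is a fin_num.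
  by rewrite ge0_fin_numE// integral_ge0// => w _; rewrite lee_fin.
have fh : (\int[P]_w (f (X 0%N w))%:E <= C%:E * \int[P]_w (h (X 0%N w))%:E)%E.
  rewrite -ge0_integralZl_EFin//; last 2 first.
  - by move=> w _; rewrite lee_fin.
  - by apply/measurable_EFinP; exact: measurableT_comp.
  apply: (@ge0_integral_comp_le _ _ _ P X f (fun x => C * h x)) => //.
    exact: measurable_funM.
  by move=> x; rewrite f0 fCh.
rewrite -lee_fin EFinM fineK//; last first.
  rewrite ge0_fin_numE; last by apply: integral_ge0 => w _; rewrite lee_fin.
  by apply: (le_lt_trans fh); rewrite lte_mul_pinfty// lee_fin.
by rewrite fineK.
Qed.

Variable g : R -> R.
Hypothesis mg : measurable_fun [set: R] g.
Hypothesis g0 : forall x, 0 <= g x.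

(** On the event g x ^+ 5 > i one has log i <= 5 L(g x). *)
Lemma high_logweight_le (c : R) (i : nat) (x : R) : 0 <= c ->
  1 <= ln (i%:R : R) ->
  high g i x * logpow c i <= 5 `^ c * logweight (- c) (g x).
Proof.
move=> c0 i1; have i0 := ln_ge1_nat_gt0 i1.
have w0 : 0 <= 5 `^ c * logweight (- c) (g x).
  by rewrite mulr_ge0 ?powR_ge0 ?logweight_ge0.
rewrite /high; case: (ltP i%:R (g x ^+ 5)) => ig; last by rewrite mulr0 mul0r.
rewrite mulr1 /logweight powRN invrK mulrCA ler_wpM2l//.
have gx0 : 0 < g x.
  rewrite lt_def g0 andbT; apply/eqP => gx; move: ig; rewrite gx expr0n/=.
  by move/(lt_trans i0); rewrite ltxx.
rewrite logpow_nat_powR// -powRM ?(ltW (Llog_gt0 _))//.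
rewrite ge0_ler_powR ?nnegrE ?mulr_ge0 ?(ltW (Llog_gt0 _))//.
  exact: le_trans i1.
apply: (@le_trans _ _ (5 * ln (g x))); last by rewrite ler_wpM2l// ln_le_Llog.
by rewrite mulr_natl -lnXn// ler_ln ?posrE ?exprn_gt0// ltW.
Qed.

(** In [truncation_deviation] the high parts are controlled by
    [weighted_sum_growth], on the path through the linear growth of the sums of
    the weights of g, and in mean through their common expectation. *)
Lemma sum_deviation_rate (c b : R) : 0 <= c -> - c < b ->
  (\int[P]_w (logweight (- c) (g (X 0%N w)))%:E < +oo)%E ->
  \forall w \ae P, \forall n \near \oo,
  `|\sum_(1 <= i < n.+1) g (X i w) -
    n%:R * fine (\int[P]_w (g (X 0%N w))%:E)%E| <= n%:R * logpow b n.
Proof.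
move=> c0 cb zoo.
pose z x := logweight (- c) (g x).
have mz : measurable_fun [set: R] z.
  by apply: measurableT_comp => //; exact: measurable_logweight.
have z0 x : 0 <= z x by exact: logweight_ge0.
have gz x : g x <= z x.
  by rewrite -[leLHS]logweight0 logweight_le// oppr_le0.
have goo : (\int[P]_w (g (X 0%N w))%:E < +oo)%E.
  apply: le_lt_trans zoo; apply: (ge0_integral_comp_le mg mz) => x.
  by rewrite g0 gz.
have zfin : (\int[P]_w (z (X 0%N w))%:E)%E \is a fin_num.
  by rewrite ge0_fin_numE// integral_ge0// => w _; rewrite lee_fin.
set Ez := fine (\int[P]_w (z (X 0%N w))%:E)%E.
have Ez0 : 0 <= Ez.
  by apply: fine_ge0; apply: integral_ge0 => w _; rewrite lee_fin.
have zK : (\int[P]_w (z (X 0%N w))%:E < (Ez + 1)%:E)%E.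
  by rewrite -[ltLHS]fineK// lte_fin ltrDl.
have mhigh i := measurable_high mg i.
have C0 : 0 <= 5 `^ c :> R by exact: powR_ge0.
have E_growth : \forall n \near \oo,
   \sum_(1 <= i < n.+1) fine (\int[P]_w (high g i (X 0%N w))%:E)%E <=
   (1 + 5 `^ c * expR (c * ln 2) * Ez) * (n%:R * logpow (- c) n).
  apply: (@weighted_sum_growth _ (fun=> Ez) _ c (5 `^ c) Ez) => //.
  - move=> i; rewrite fine_ge0/=; last first.
      by apply: integral_ge0 => w _; rewrite lee_fin high_ge0.
    rewrite -[leRHS]mul1r; apply: fine_integral_le => //.
      by move=> x; exact: high_ge0.
    by move=> x; rewrite mul1r (le_trans _ (gz x))// high_le.
  - move=> i i1; have lc := logpow_gt0 c i.
    rewrite -ler_pdivlMr// mulrAC; apply: fine_integral_le => //.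
    + by move=> x; exact: high_ge0.
    + by rewrite divr_ge0// ltW.
    + by move=> x; rewrite mulrAC ler_pdivlMr// high_logweight_le.
  - by apply: nearW => n; rewrite sumr_const_nat subn1 /= mulr_natr.
have := truncation_deviation hX mg g0 goo.
have := sum_le_linear hX mz z0 zK.
apply: filterS2 => w Hz Ht.
have X_growth : \forall n \near \oo,
   \sum_(1 <= i < n.+1) high g i (X i w) <=
   (1 + 5 `^ c * expR (c * ln 2) * (2 * (Ez + 1))) * (n%:R * logpow (- c) n).
  apply: (@weighted_sum_growth _ (fun i => z (X i w)) _ c (5 `^ c)) => //.
  - by rewrite mulr_ge0// addr_ge0.
  - by move=> i; rewrite high_ge0//= (le_trans _ (gz _))// high_le.
  - by move=> i i1; exact: high_logweight_le.
move: E_growth X_growth.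
set C1 := 1 + _; set C2 := 1 + _; set mu := fine _.
set A := 16 + 31 * mu => E_growth X_growth.
near=> n.
have h1 : \sum_(1 <= i < n.+1) fine (\int[P]_w (high g i (X 0%N w))%:E)%E <=
   C1 * (n%:R * logpow (- c) n) by near: n.
have h2 : \sum_(1 <= i < n.+1) high g i (X i w) <= C2 * (n%:R * logpow (- c) n).
  by near: n.
have h3 : A * n%:R `^ (4 / 5) <= n%:R * logpow (- c) n.
  by near: n; exact: root_absorb.
have h4 : (1 + C2 + C1) * logpow (- c) n <= logpow b n.
  by near: n; exact: logpow_absorb.
have h5 : n%:R * ((1 + C2 + C1) * logpow (- c) n) <= n%:R * logpow b n.
  by rewrite ler_wpM2l.
apply: le_trans h5.
have -> : n%:R * ((1 + C2 + C1) * logpow (- c) n) = n%:R * logpow (- c) n +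
  C2 * (n%:R * logpow (- c) n) + C1 * (n%:R * logpow (- c) n) by ring.
apply: (@le_trans _ _ (A * n%:R `^ (4 / 5) + \sum_(1 <= i < n.+1) high g i (X i w)
  + \sum_(1 <= i < n.+1) fine (\int[P]_w (high g i (X 0%N w))%:E)%E)).
  by near: n.
by rewrite !lerD.
Unshelve. all: by end_near. Qed.

(** The low parts increase to g, so their means converge to the mean of g. *)
Lemma high_mean_small (eps : R) :
  (\int[P]_w (g (X 0%N w))%:E < +oo)%E -> 0 < eps ->
  exists M, (\int[P]_w (high g M (X 0%N w))%:E < eps%:E)%E.
Proof.
move=> goo eps0.
have mlow i := measurable_low mg i.
have gfin : (\int[P]_w (g (X 0%N w))%:E)%E \is a fin_num.
  by rewrite ge0_fin_numE// integral_ge0// => w _; rewrite lee_fin.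
have lowg i x : 0 <= low g i x <= g x by rewrite low_ge0// low_le.
have lowfin i : (\int[P]_w (low g i (X 0%N w))%:E)%E \is a fin_num.
  by have := dominated_integral_fin_num mg goo (mlow i) (lowg i).
have cvg_low : (\int[P]_w (low g i (X 0%N w))%:E)%E @[i --> \oo] -->
    (\int[P]_w (g (X 0%N w))%:E)%E.
  have -> : (\int[P]_w (g (X 0%N w))%:E)%E =
      (\int[P]_w (limn (fun i => (low g i (X 0%N w))%:E)))%E.
    apply: eq_integral => w _; apply/esym/cvg_lim => //.
    apply: cvg_near_cst; near=> i.
    have : g (X 0%N w) ^+ 5 <= i%:R by near: i; exact: nbhs_infty_ger.
    by rewrite /low => ->; rewrite mulr1.
  apply: cvg_monotone_convergence => //.
  - by move=> i; apply/measurable_EFinP; exact: measurableT_comp.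
  - by move=> i w _; rewrite lee_fin low_ge0.
  - move=> w _ i j ij; rewrite lee_fin ler_wpM2l//.
    case: (leP (g (X 0%N w) ^+ 5) i%:R) => //= h.
    by rewrite (le_trans h)// ler_nat.
have : \forall i \near \oo, ((fine (\int[P]_w (g (X 0%N w))%:E)%E - eps)%:E <
    \int[P]_w (low g i (X 0%N w))%:E)%E.
  move: cvg_low; rewrite -(fineK gfin) => /fine_cvgP[_ /cvgrPdist_lt /(_ eps eps0)].
  apply: filterS => i; rewrite ltr_norml => /andP[_ h].
  by rewrite -[ltRHS]fineK// lte_fin; move: h => /=; lra.
move=> [M _ /(_ M (leqnn M)) HM]; exists M.
have highfin : (\int[P]_w (high g M (X 0%N w))%:E)%E \is a fin_num.
  have highg x : 0 <= high g M x <= g x by rewrite high_ge0// high_le.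
  by have := dominated_integral_fin_num mg goo (measurable_high mg M) highg.
move: HM; rewrite (integral_low_high mg g0 M) fineD//.
rewrite -(fineK (lowfin M)) -(fineK highfin) !lte_fin /=; lra.
Unshelve. all: by end_near. Qed.

(** The high parts are dominated, apart from finitely many indices, by a single
    function [high g M] of mean below eps / 8, whose sums grow at most at twice
    that rate. Of the eight shares of eps, six are spent. *)
Lemma slln_nneg (eps : R) : (\int[P]_w (g (X 0%N w))%:E < +oo)%E -> 0 < eps ->
  \forall w \ae P, \forall n \near \oo,
  `|\sum_(1 <= i < n.+1) g (X i w) -
    n%:R * fine (\int[P]_w (g (X 0%N w))%:E)%E| <= eps * n%:R.
Proof.
move=> goo eps0.
have e8 : 0 < eps / 8 by rewrite divr_gt0.
have [M HM] := high_mean_small goo e8.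
have mhighM := measurable_high mg M.
have highM0 := high_ge0 g0 M.
have gfin : (\int[P]_w (g (X 0%N w))%:E)%E \is a fin_num.
  by rewrite ge0_fin_numE// integral_ge0// => w _; rewrite lee_fin.
have anti i x : (M <= i)%N -> high g i x <= high g M x.
  move=> Mi; rewrite /high ler_wpM2l//; case: (ltP i%:R) => //= h.
  by rewrite (le_lt_trans _ h)// ler_nat.
set mu := fine _; have mu0 : 0 <= mu.
  by apply: fine_ge0; apply: integral_ge0 => w _; rewrite lee_fin.
have tail_split (u v s : nat -> R) n : (forall i, 0 <= v i) ->
    (forall i, 0 <= s i) ->
    (forall i, u i <= s i) -> (forall i, (M <= i)%N -> u i <= v i) ->
    \sum_(1 <= i < n.+1) u i <=
    \sum_(1 <= i < M.+1) s i + \sum_(1 <= i < n.+1) v i.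
  move=> v0 s0 us uv; have [nM|Mn] := leqP n M.
    apply: (@le_trans _ _ (\sum_(1 <= i < n.+1) s i)); first exact: ler_sum.
    apply: (@le_trans _ _ (\sum_(1 <= i < M.+1) s i)); first exact: sum_nat_le.
    by rewrite lerDl sumr_ge0.
  rewrite (@big_cat_nat _ _ _ M.+1)//=; last by rewrite ltnS ltnW.
  apply: lerD; first exact: ler_sum.
  apply: (@le_trans _ _ (\sum_(M.+1 <= i < n.+1) v i)).
    rewrite big_seq [leRHS]big_seq; apply: ler_sum => i.
    by rewrite mem_index_iota => /andP[Mi _]; apply: uv; exact: ltnW.
  rewrite [leRHS](@big_cat_nat _ _ _ M.+1)//=; last by rewrite ltnS ltnW.
  by rewrite lerDr sumr_ge0.
have := truncation_deviation hX mg g0 goo.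
have := sum_le_linear hX mhighM highM0 HM.
apply: filterS2 => w Hz Ht.
near=> n.
have n0 : 0 < n%:R :> R by rewrite ltr0n; near: n; exact: nbhs_infty_gt.
have nr (A : R) : A <= n%:R -> A * (eps / 8) <= n%:R * (eps / 8).
  by move=> An; rewrite ler_wpM2r// ltW.
have h1 : \sum_(1 <= i < n.+1) high g i (X i w) <=
    n%:R * (eps / 8) + 2 * (eps / 8) * n%:R.
  apply: (le_trans (tail_split _ (fun i => high g M (X i w))
    (fun i => g (X i w)) n _ _ _ _)) => //.
  - by move=> i; exact: high_le.
  - by move=> i; exact: anti.
  - apply: lerD; last by near: n.
    rewrite -ler_pdivrMr//; near: n; exact: nbhs_infty_ger.
have h2 : \sum_(1 <= i < n.+1) fine (\int[P]_w (high g i (X 0%N w))%:E)%E <=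
    n%:R * (eps / 8) + (eps / 8) * n%:R.
  apply: (le_trans (tail_split _ (fun=> eps / 8) (fun=> mu) n _ _ _ _)) => //.
  - by move=> i; exact: ltW.
  - move=> i; rewrite -[leRHS]mul1r; apply: fine_integral_le => //.
    + exact: measurable_high.
    + by move=> x; exact: high_ge0.
    + by move=> x; rewrite mul1r high_le.
  - move=> i Mi; apply: (@le_trans _ _ (fine (\int[P]_w (high g M (X 0%N w))%:E)%E)).
      rewrite -[leRHS]mul1r; apply: fine_integral_le => //.
      + exact: measurable_high.
      + by move=> x; exact: high_ge0.
      + by move=> x; rewrite mul1r anti.
      + by apply: lt_trans HM _; rewrite ltry.
    rewrite -lee_fin fineK ?ltW// ge0_fin_numE ?(lt_trans HM) ?ltry//.
    by apply: integral_ge0 => v _; rewrite lee_fin.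
  - rewrite !sumr_const_nat !subn1 /=.
    rewrite [X in _ + X <= _](_ : _ = eps / 8 * n%:R) ?mulr_natr//.
    rewrite lerD2r -ler_pdivrMr//; near: n; exact: nbhs_infty_ger.
have h3 : (16 + 31 * mu) / (eps / 8) * n%:R `^ (4 / 5) <= n%:R * logpow 0 n.
  by near: n; exact: root_absorb.
have h4 : (16 + 31 * mu) * n%:R `^ (4 / 5) <= n%:R * (eps / 8).
  move: h3; rewrite /logpow mul0r expR0 mulr1 mulrAC ler_pdivrMr//.
apply: (@le_trans _ _ ((16 + 31 * mu) * n%:R `^ (4 / 5) +
  \sum_(1 <= i < n.+1) high g i (X i w)
  + \sum_(1 <= i < n.+1) fine (\int[P]_w (high g i (X 0%N w))%:E)%E)).
  by near: n.
have en : 0 < eps * n%:R by rewrite mulr_gt0.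
apply: (le_trans (lerD (lerD h4 h1) h2)); lra.
Unshelve. all: by end_near. Qed.

End rates.

(** * Signed summands: centred and non-centred sums *)

Section signed.
Context {R : realType} {d : measure_display} {T : measurableType d}.
Context {P : probability T R} {X : nat -> {RV P >-> R}}.
Hypothesis hX : iid X.

Definition pos_part (x : R) : R := Num.max x 0.
Definition neg_part (x : R) : R := Num.max (- x) 0.

Lemma pos_part_ge0 x : 0 <= pos_part x. Proof. by rewrite le_max lexx orbT. Qed.
Lemma neg_part_ge0 x : 0 <= neg_part x. Proof. by rewrite le_max lexx orbT. Qed.

Lemma pos_part_le x : pos_part x <= `|x|.
Proof. by rewrite ge_max ler_norm normr_ge0. Qed.

Lemma neg_part_le x : neg_part x <= `|x|.
Proof. by rewrite ge_max -normrN ler_norm normr_ge0. Qed.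

Lemma pos_partBneg_part x : pos_part x - neg_part x = x.
Proof.
rewrite /pos_part /neg_part; have /orP[x0|x0] := le_total 0 x.
  by rewrite max_l// max_r ?subr0// oppr_le0.
by rewrite max_r// max_l ?oppr_ge0// sub0r opprK.
Qed.

Lemma measurable_pos_part : measurable_fun [set: R] pos_part.
Proof. exact: measurable_maxr. Qed.

Lemma measurable_neg_part : measurable_fun [set: R] neg_part.
Proof. by apply: measurable_maxr => //; exact: measurableT_comp. Qed.

(** The moment condition passes from |X| to its positive and negative parts. *)
Lemma logweight_homo (b x y : R) : b <= 0 -> 0 <= x -> x <= y ->
  logweight b x <= logweight b y.
Proof.
move=> b0 x0 xy; rewrite /logweight -!powRN.
apply: ler_pM => //; first exact: powR_ge0.
rewrite ge0_ler_powR ?nnegrE ?oppr_ge0 ?(ltW (Llog_gt0 _))//.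
exact: Llog_le.
Qed.

Let L b := (\int[P]_w (logweight b `|X 0%N w|)%:E)%E.
Let mupos := fine (\int[P]_w (pos_part (X 0%N w))%:E)%E.
Let muneg := fine (\int[P]_w (neg_part (X 0%N w))%:E)%E.

Lemma expectation_norm_logweight0 : ('E_P[fun w => `|X 0%N w|%R] = L 0)%E.
Proof.
by rewrite unlock; apply: eq_integral => w _; rewrite logweight0.
Qed.

Lemma part_moment_lty (g : R -> R) (b : R) : measurable_fun [set: R] g ->
  (forall x, 0 <= g x <= `|x|) -> b <= 0 -> (L b < +oo)%E ->
  (\int[P]_w (logweight b (g (X 0%N w)))%:E < +oo)%E.
Proof.
move=> mg gx b0; apply: le_lt_trans.
apply: (@ge0_integral_comp_le _ _ _ P X (fun x => logweight b (g x))
  (fun x => logweight b `|x|)).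
- by apply: measurableT_comp => //; exact: measurable_logweight.
- by apply: measurableT_comp => //; exact: measurable_logweight.
- move=> x; have /andP[g0 gl] := gx x.
  by rewrite logweight_ge0//= logweight_homo.
Qed.

Lemma part_mean_lty (g : R -> R) : measurable_fun [set: R] g ->
  (forall x, 0 <= g x <= `|x|) -> (L 0 < +oo)%E ->
  (\int[P]_w (g (X 0%N w))%:E < +oo)%E.
Proof.
move=> mg gx L0; have := part_moment_lty mg gx (lexx 0) L0.
by under eq_integral do rewrite logweight0.
Qed.

Let posb x : 0 <= pos_part x <= `|x|.
Proof. by rewrite pos_part_ge0 pos_part_le. Qed.
Let negb x : 0 <= neg_part x <= `|x|.
Proof. by rewrite neg_part_ge0 neg_part_le. Qed.

Lemma integrable_of_moment0 : (L 0 < +oo)%E -> P.-integrable [set: T] (EFin \o X 0%N).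
Proof.
move=> L0; apply/integrableP; split.
  by apply/measurable_EFinP.
by move: L0; rewrite /L; under eq_integral do rewrite logweight0.
Qed.

Lemma expectation_parts : (L 0 < +oo)%E ->
  ('E_P[X 0%N] = (mupos - muneg)%R%:E)%E.
Proof.
move=> L0.
have pfin : (\int[P]_w (pos_part (X 0%N w))%:E)%E \is a fin_num.
  rewrite ge0_fin_numE; first exact: part_mean_lty measurable_pos_part posb L0.
  by apply: integral_ge0 => w _; rewrite lee_fin pos_part_ge0.
have nfin : (\int[P]_w (neg_part (X 0%N w))%:E)%E \is a fin_num.
  rewrite ge0_fin_numE; first exact: part_mean_lty measurable_neg_part negb L0.
  by apply: integral_ge0 => w _; rewrite lee_fin neg_part_ge0.
have posint : P.-integrable [set: T] (EFin \o (pos_part \o X 0%N)).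
  apply/integrableP; split.
    by apply/measurable_EFinP; apply: measurableT_comp => //; exact: measurable_pos_part.
  under eq_integral => w _ do rewrite /= ger0_norm ?pos_part_ge0//.
  exact: part_mean_lty measurable_pos_part posb L0.
have negint : P.-integrable [set: T] (EFin \o (neg_part \o X 0%N)).
  apply/integrableP; split.
    by apply/measurable_EFinP; apply: measurableT_comp => //; exact: measurable_neg_part.
  under eq_integral => w _ do rewrite /= ger0_norm ?neg_part_ge0//.
  exact: part_mean_lty measurable_neg_part negb L0.
rewrite EFinB /mupos /muneg !fineK// unlock.
rewrite -(integralB_EFin measurableT posint negint).
by apply: eq_integral => w _; rewrite -EFinB /= pos_partBneg_part.
Qed.

Lemma psum_parts w n : psum (fun i => X i w) n =
  \sum_(1 <= i < n.+1) pos_part (X i w) - \sum_(1 <= i < n.+1) neg_part (X i w).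
Proof.
by rewrite -sumrB; apply: eq_bigr => i _; rewrite pos_partBneg_part.
Qed.

(** The two parts have the same mean, so the centrings cancel in the difference. *)
Lemma centered_growth (b c : R) : b <= 0 -> b < c -> (L b < +oo)%E ->
  ('E_P[X 0%N] = 0)%E -> \forall w \ae P, growth_le (fun i => X i w) c.
Proof.
move=> b0 bc Lb EX0; pose e := (b + c) / 2.
have be : - - b < e by rewrite opprK /e; lra.
have ec : e < c by rewrite /e; lra.
have L0 : (L 0 < +oo)%E.
  apply: le_lt_trans Lb; apply: (@ge0_integral_comp_le _ _ _ P X
   (fun x => logweight 0 `|x|) (fun x => logweight b `|x|)).
  - by apply: measurableT_comp => //; exact: measurable_logweight.
  - by apply: measurableT_comp => //; exact: measurable_logweight.
  - by move=> x; rewrite logweight_ge0//= logweight_le.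
have mm : mupos = muneg.
  by have := expectation_parts L0; rewrite EX0 => -[] /esym/eqP; rewrite subr_eq0 => /eqP.
have Nb : 0 <= - b by rewrite oppr_ge0.
have Hp := @sum_deviation_rate _ _ _ P X hX _
  measurable_pos_part pos_part_ge0 (- b) e Nb be.
have Hn := @sum_deviation_rate _ _ _ P X hX _
  measurable_neg_part neg_part_ge0 (- b) e Nb be.
rewrite opprK in Hp Hn.
have := Hp (part_moment_lty measurable_pos_part posb b0 Lb).
have := Hn (part_moment_lty measurable_neg_part negb b0 Lb).
apply: filterS2 => w; rewrite -/mupos -/muneg mm => {}Hn {}Hp.
rewrite /growth_le; near=> n.
have h1 : `|\sum_(1 <= i < n.+1) pos_part (X i w) - n%:R * muneg| <= n%:R * logpow e n.
  by near: n.
have h2 : `|\sum_(1 <= i < n.+1) neg_part (X i w) - n%:R * muneg| <= n%:R * logpow e n.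
  by near: n.
have h3 : 2 * logpow e n <= logpow c n by near: n; exact: logpow_absorb.
have h4 : n%:R * (2 * logpow e n) <= n%:R * logpow c n by rewrite ler_wpM2l.
rewrite psum_parts; move: h1 h2; rewrite !ler_norml => /andP[p1 p2] /andP[q1 q2].
apply/andP; split; lra.
Unshelve. all: by end_near. Qed.

Lemma slln (eps : R) : (L 0 < +oo)%E -> 0 < eps ->
  \forall w \ae P, \forall n \near \oo,
    `|psum (fun i => X i w) n - n%:R * fine ('E_P[X 0%N])%E| <= eps * n%:R.
Proof.
move=> L0 eps0; have e2 : 0 < eps / 2 by rewrite divr_gt0.
rewrite (expectation_parts L0) /=.
have := slln_nneg hX measurable_pos_part pos_part_ge0
  (part_mean_lty measurable_pos_part posb L0) e2.
have := slln_nneg hX measurable_neg_part neg_part_ge0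
  (part_mean_lty measurable_neg_part negb L0) e2.
apply: filterS2 => w; rewrite -/mupos -/muneg.
apply: filterS2 => n; rewrite psum_parts !ler_norml => /andP[p1 p2] /andP[q1 q2].
apply/andP; split; lra.
Qed.

(** The strong law keeps |S_n| / n between |EX| / 2 and 2 |EX|, and any nonzero power
    of log n eventually leaves this range. *)
Lemma noncentered_growth (b : R) : (L 0 < +oo)%E -> ('E_P[X 0%N] <> 0)%E -> 0 < b ->
  \forall w \ae P, growth_le (fun i => X i w) b /\
    \forall n \near \oo, n%:R * logpow (- b) n < `|psum (fun i => X i w) n|.
Proof.
move=> L0 EX0 b0.
set m := fine ('E_P[X 0%N])%E.
have m0 : 0 < `|m|.
  rewrite normr_gt0; apply/eqP => m0; apply: EX0.
  by move: m0; rewrite /m (expectation_parts L0) /= => ->.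
have m2 : 0 < `|m| / 2 by rewrite divr_gt0.
apply: filterS (slln L0 m2) => w H; rewrite -/m in H.
have Nb0 : - b < 0 by rewrite oppr_lt0.
suff K : \forall n \near \oo, n%:R * logpow (- b) n <
    `|psum (fun i => X i w) n| <= n%:R * logpow b n.
  by split; apply: filterS K => n /andP[].
near=> n.
have n0 : 0 < n%:R :> R by rewrite ltr0n; near: n; exact: nbhs_infty_gt.
have h : `|psum (fun i => X i w) n - n%:R * m| <= `|m| / 2 * n%:R by near: n.
have nm : `|n%:R * m| = n%:R * `|m| by rewrite normrM ger0_norm// ltW.
have up : `|psum (fun i => X i w) n| <= 2 * `|m| * n%:R.
  have := ler_normD (psum (fun i => X i w) n - n%:R * m) (n%:R * m).
  rewrite subrK nm; nra.
have lo : `|m| / 2 * n%:R <= `|psum (fun i => X i w) n|.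
  have := ler_normB (psum (fun i => X i w) n) (psum (fun i => X i w) n - n%:R * m).
  rewrite opprB addrC subrK nm; lra.
have l0 k : logpow 0 k = 1 :> R by rewrite /logpow mul0r expR0.
have c1 : 2 * `|m| * logpow 0 n <= logpow b n by near: n; exact: logpow_absorb.
have c2 : 4 / `|m| * logpow (- b) n <= logpow 0 n by near: n; exact: logpow_absorb.
rewrite l0 in c1 c2; apply/andP; split.
  apply: lt_le_trans lo; rewrite mulrC ltr_pM2r//.
  move: c2; rewrite mulrAC ler_pdivrMr// mul1r => c2.
  have := logpow_gt0 (- b) n; lra.
apply: (le_trans up); rewrite mulrC ler_wpM2l//; last lra.
Unshelve. all: by end_near. Qed.

End signed.

(** * The limit superior and the moment exponent *)

(** The limit superior is characterized by eventual upper bounds; nonnegative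
    bounds of the form e^b suffice because e^beta > 0. *)
Lemma limn_esup_expR_iff {R : realType} (u : nat -> R) (beta : R) :
  limn_esup (fun n => (u n)%:E) = (expR beta)%:E <->
  (forall b, beta < b -> \forall n \near \oo, u n <= expR b) /\
  (forall b, b < beta -> ~ \forall n \near \oo, u n <= expR b).
Proof.
rewrite /limn_esup limf_esupE; set l := ereal_inf _.
have le_l (c : R) : (\forall n \near \oo, u n <= c) -> (l <= c%:E)%E.
  move=> uc; apply: ge_ereal_inf.
  exists (ereal_sup [set (u n)%:E | n in [set n | u n <= c]]).
    by exists [set n | u n <= c].
  by apply: ub_ereal_sup => _ [n /= unc <-]; rewrite lee_fin.
have l_lt (c : R) : (l < c%:E)%E -> \forall n \near \oo, u n <= c.
  move=> /ereal_inf_lt[_ [V Voo <-]] supV; apply: filterS Voo => n Vn.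
  rewrite -lee_fin; apply: le_trans (ltW supV).
  by apply: ereal_sup_ubound; exists n.
split=> [lE|[U V]].
  split=> b bb.
    by apply: l_lt; rewrite lE lte_fin ltr_expR.
  by move=> /le_l; rewrite lE lee_fin ler_expR leNgt bb.
apply/eqP; rewrite eq_le; apply/andP; split.
  apply/lee_addgt0Pr => e e0; rewrite -EFinD.
  have p0 : 0 < expR beta + e by rewrite addr_gt0// expR_gt0.
  rewrite -[expR beta + e]lnK ?posrE//; apply/le_l/U.
  by rewrite -ltr_expR lnK ?posrE// ltrDl.
rewrite leNgt; apply/negP => lb.
have [b bb lb'] : exists2 b, b < beta & (l < (expR b)%:E)%E.
  case: (l) lb => [r| |] //.
    rewrite lte_fin => rb.
    pose s := (Num.max r 0 + expR beta) / 2.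
    have s0 : Num.max r 0 < expR beta by rewrite gt_max rb expR_gt0.
    have m0 : 0 <= Num.max r 0 by rewrite le_max lexx orbT.
    have rm : r <= Num.max r 0 by rewrite le_max lexx.
    have sp : 0 < s by rewrite /s; have := expR_gt0 beta; lra.
    exists (ln s); first by rewrite -ltr_expR lnK ?posrE// /s; lra.
    by rewrite lnK ?posrE// lte_fin /s; lra.
  by move=> _; exists (beta - 1); rewrite ?ltNyr//; lra.
exact: V bb (l_lt _ lb').
Qed.

Lemma exists_inv_nat_le {R : realType} (e : R) : 0 < e ->
  exists k : nat, k.+1%:R^-1 <= e.
Proof.
move=> e0; exists (Num.bound e^-1).
rewrite invf_ple ?posrE// ltW// (lt_le_trans (archi_boundP _))//.
  by rewrite invr_ge0 ltW.
by rewrite ler_nat.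
Qed.

Section exponent.
Context {R : realType} {d : measure_display} {T : measurableType d}.
Context {P : probability T R} {X : nat -> {RV P >-> R}}.

Lemma ae_contradiction (A : T -> Prop) :
  (\forall w \ae P, A w) -> (\forall w \ae P, ~ A w) -> False.
Proof.
move=> HA HN.
have : \forall w \ae P, False by apply: filterS2 HA HN => w a /(_ a).
case=> N [mN PN sub].
have NT : N = setT by apply/seteqP; split => // w _; apply: sub => /=.
by move: PN; rewrite NT probability_setT => /eqP; rewrite onee_eq0.
Qed.

Lemma normed_mean_le_near (w : T) (b : R) : \forall n \near \oo,
  (normed_mean X n w <= expR b) = (`|psum (fun i => X i w) n| <= n%:R * logpow b n).
Proof.
near=> n.
have n0 : 0 < n%:R :> R by rewrite ltr0n; near: n; exact: nbhs_infty_gt.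
have l1 : 1 <= ln (ln (n%:R : R)) by near: n; exact: lnln_nat_near.
rewrite /normed_mean powR_inv_le_expR// ?(lt_le_trans ltr01 l1)//.
by rewrite normrM normfV (ger0_norm (ltW n0)) ler_pdivrMr// mulrC.
Unshelve. all: by end_near. Qed.

Lemma normed_mean_growth (w : T) (b : R) :
  (\forall n \near \oo, normed_mean X n w <= expR b) <->
  growth_le (fun i => X i w) b.
Proof.
split; apply: filterS2 (normed_mean_le_near w b) => n.
  by move=> ->.
by rewrite /growth_le => ->.
Qed.

(** Countably many b near beta suffice, so the quantifier over b and the almost
    sure quantifier may be exchanged; each b can then be treated separately. *)
Lemma ae_limsup_iff (beta : R) :
  (\forall w \ae P, limn_esup (fun n => (normed_mean X n w)%:E) = (expR beta)%:E)
  <->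
  (forall b, beta < b -> \forall w \ae P, growth_le (fun i => X i w) b) /\
  (forall b, b < beta -> \forall w \ae P, ~ growth_le (fun i => X i w) b).
Proof.
split=> [H|[U V]].
  split=> b bb; apply: filterS H => w /limn_esup_expR_iff[U V].
    exact/normed_mean_growth/U.
  by move=> /normed_mean_growth; exact: V.
have U' : \forall w \ae P, forall k, growth_le (fun i => X i w) (beta + k.+1%:R^-1).
  by apply: ae_foralln => k; apply: U; rewrite ltrDl invr_gt0.
have V' : \forall w \ae P, forall k, ~ growth_le (fun i => X i w) (beta - k.+1%:R^-1).
  by apply: ae_foralln => k; apply: V; rewrite ltrBlDr ltrDl invr_gt0.
apply: filterS2 U' V' => w {}U {}V; apply/limn_esup_expR_iff.
split=> b bb.
  apply/normed_mean_growth.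
  have [|k kb] := @exists_inv_nat_le _ (b - beta); first by rewrite subr_gt0.
  by apply: growth_leW (U k); rewrite -lerBrDl.
move/normed_mean_growth => Gb.
have [|k kb] := @exists_inv_nat_le _ (beta - b); first by rewrite subr_gt0.
by apply: (V k); apply: growth_leW Gb; rewrite lerBrDr -lerBrDl.
Qed.

Let L b := (\int[P]_w (logweight b `|X 0%N w|)%:E)%E.

Lemma logweight_moment_le (b c : R) : b <= c -> (L b < +oo)%E -> (L c < +oo)%E.
Proof.
move=> bc; apply: le_lt_trans; apply: (@ge0_integral_comp_le _ _ _ P X
   (fun x => logweight c `|x|) (fun x => logweight b `|x|)).
- by apply: measurableT_comp => //; exact: measurable_logweight.
- by apply: measurableT_comp => //; exact: measurable_logweight.
- by move=> x; rewrite logweight_ge0//= logweight_le.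
Qed.

Let logweight_expectation b :
  'E_P[fun w => (`|X 0%N w| / Llog `|X 0%N w| `^ b)%R]%E = L b.
Proof. by rewrite unlock. Qed.

Lemma moment_exponent_gt (b : R) :
  (b%:E < moment_exponent (X 0%N))%E -> ~ (L b < +oo)%E.
Proof.
move=> bB Lb; move: bB; rewrite ltNge => /negP; apply.
by apply: ereal_inf_lbound; exists b => //=; rewrite logweight_expectation.
Qed.

(** The set of exponents with finite moment is closed upwards. *)
Lemma moment_exponent_lt (b : R) :
  (moment_exponent (X 0%N) < b%:E)%E -> (L b < +oo)%E.
Proof.
move=> /ereal_inf_lt[_ [c /= Lc <-]]; rewrite lte_fin => cb.
by apply: logweight_moment_le (ltW cb) _; rewrite -logweight_expectation.
Qed.

End exponent.

Lemma lte_real_between {R : realType} (x : \bar R) (b : R) :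
  (x < b%:E)%E -> exists2 c : R, (x < c%:E)%E & c < b.
Proof.
case: x => [r| |]//=; last first.
  by move=> _; exists (b - 1); rewrite ?ltNyr//; lra.
by rewrite lte_fin => rb; exists ((r + b) / 2); rewrite ?lte_fin; lra.
Qed.

Lemma gte_real_between {R : realType} (x : \bar R) (b : R) :
  (b%:E < x)%E -> exists2 c : R, (c%:E < x)%E & b < c.
Proof.
case: x => [r| |]//=; last first.
  by move=> _; exists (b + 1); rewrite ?ltry//; lra.
by rewrite lte_fin => rb; exists ((r + b) / 2); rewrite ?lte_fin; lra.
Qed.

(* The sequence X, X_1, X_2, ... is [X 0], [X 1], [X 2], ... *)
Theorem theorem2p4 (R : realType) (d : measure_display) (T : measurableType d)
    (P : probability T R) (beta : R) (X : nat -> {RV P >-> R}) (hX : iid X) :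
  ({ae P, forall w,
      limn_esup (fun n => (normed_mean X n w)%:E) = (expR beta)%:E} <->
   [/\ 0 < beta -> moment_exponent (X 0%N) = beta%:E,
       beta = 0 ->
         (('E_P[fun w => `|X 0%N w|%R] < +oo)%E /\ ('E_P[X 0%N] <> 0)%E) \/
         moment_exponent (X 0%N) = 0%E
     & beta < 0 ->
         (P.-integrable [set: T] (EFin \o X 0%N) /\ ('E_P[X 0%N] = 0)%E) /\
         moment_exponent (X 0%N) = beta%:E])
  /\
  (('E_P[fun w => `|X 0%N w|%R] < +oo)%E -> ('E_P[X 0%N] <> 0)%E ->
   {ae P, forall w, normed_mean X n w @[n --> \oo] --> (1 : R)}).
Proof.
set B := moment_exponent (X 0%N).
rewrite expectation_norm_logweight0; split; last first.
  move=> L0 EX0.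
  have H : \forall w \ae P, forall k, growth_le (fun i => X i w) k.+1%:R^-1 /\
      \forall n \near \oo, n%:R * logpow (- k.+1%:R^-1) n < `|psum (fun i => X i w) n|.
    by apply: ae_foralln => k; apply: noncentered_growth => //; rewrite invr_gt0.
  apply: filterS H => w H; apply/cvgrPdist_le => e e0.
  have ln0 : 0 < ln (1 + e) by rewrite ln_gt0// ltrDl.
  have [|k] := @exists_inv_nat_le _ (Num.min (ln (1 + e)) e).
    by rewrite lt_min ln0.
  rewrite le_min => /andP[kln ke].
  have [up lo] := H k.
  near=> n.
  have up_n : normed_mean X n w <= expR (k.+1%:R^-1).
    by near: n; exact/normed_mean_growth.
  have lo_n : ~~ (normed_mean X n w <= expR (- k.+1%:R^-1)).
    have -> : (normed_mean X n w <= expR (- k.+1%:R^-1)) =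
        (`|psum (fun i => X i w) n| <= n%:R * logpow (- k.+1%:R^-1) n).
      by near: n; exact: normed_mean_le_near.
    by rewrite -ltNge; near: n.
  rewrite -ltNge in lo_n.
  have lo1 := le_lt_trans (expR_ge1Dx (- k.+1%:R^-1)) lo_n.
  have up1 : normed_mean X n w <= 1 + e.
    by apply: (le_trans up_n); rewrite -[leRHS]lnK ?ler_expR// posrE addr_gt0.
  move: ke lo1 up1; move: (k.+1%:R^-1) (normed_mean X n w) => q u qe lo1 up1.
  by rewrite ler_norml; apply/andP; split; lra.
apply: (iff_trans (ae_limsup_iff beta)).
have lower : (beta%:E <= B)%E -> forall b, b < beta ->
    \forall w \ae P, ~ growth_le (fun i => X i w) b.
  move=> betaB b bb; pose c := (b + beta) / 2.
  have cB : (c%:E < B)%E by apply: lt_le_trans betaB; rewrite lte_fin /c; lra.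
  apply: (infinite_moment_no_growth hX (moment_exponent_gt cB)); rewrite /c; lra.
split=> [[U V]|[Hpos Hzero Hneg]].
  have Bbeta : (B <= beta%:E)%E.
    rewrite leNgt; apply/negP => /gte_real_between[c cB bc].
    have bm : beta < (beta + c) / 2 by lra.
    apply: (ae_contradiction (U _ bm)).
    apply: (infinite_moment_no_growth hX (moment_exponent_gt cB)); lra.
  have finite0 : (B < 0)%E -> (\int[P]_w (logweight 0 `|X 0%N w|)%:E < +oo)%E.
    exact: moment_exponent_lt.
  have B_ge : beta <= 0 -> ('E_P[X 0%N] = 0)%E -> (beta%:E <= B)%E.
    move=> beta0 EX0; rewrite leNgt; apply/negP => /lte_real_between[c Bc cb].
    have mb : (c + beta) / 2 < beta by lra.
    apply: (ae_contradiction _ (V _ mb)).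
    apply: (centered_growth hX _ _ (moment_exponent_lt Bc) EX0); lra.
  split=> [beta0|beta0|beta0].
  - apply/eqP; rewrite eq_le Bbeta/= leNgt; apply/negP => /lte_real_between[c Bc cb].
    (* [finite_moment_growth] applies to exponents >= 0 only. *)
    pose c' := Num.max c 0.
    have c'b : c' < beta by rewrite /c' gt_max cb.
    have c'0 : 0 <= c' by rewrite /c' le_max lexx orbT.
    have Bc' : (B < c'%:E)%E.
      by apply: (lt_le_trans Bc); rewrite lee_fin le_max lexx.
    have mb : (c' + beta) / 2 < beta by lra.
    apply: (ae_contradiction _ (V _ mb)).
    apply: (finite_moment_growth hX c'0 _ (moment_exponent_lt Bc')); lra.
  - have [|H] := pselect ((\int[P]_w (logweight 0 `|X 0%N w|)%:E < +oo)%E /\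
        ('E_P[X 0%N] <> 0)%E); [by left|right].
    have E0 : beta%:E = 0%E by rewrite beta0.
    rewrite -E0; apply/eqP; rewrite eq_le Bbeta/= leNgt; apply/negP => B0.
    have EX0 : ('E_P[X 0%N] = 0)%E.
      apply: contrapT => EX; apply: H; split => //.
      by apply: finite0; rewrite -E0.
    have beta_le0 : beta <= 0 by rewrite beta0.
    by have := B_ge beta_le0 EX0; rewrite leNgt B0.
  - have L0 : (\int[P]_w (logweight 0 `|X 0%N w|)%:E < +oo)%E.
      by apply: finite0; apply: le_lt_trans Bbeta _; rewrite lte_fin.
    have EX0 : ('E_P[X 0%N] = 0)%E.
      apply: contrapT => EX.
      have b2 : 0 < - (beta / 2) by lra.
      have bb : beta < beta / 2 by lra.
      apply: (ae_contradiction (U _ bb)).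
      apply: filterS (noncentered_growth hX L0 EX b2) => w [_ H] G.
      have [n [/= h1 h2]] := filter_ex (filterI H G).
      by move: h1; rewrite opprK ltNge h2.
    split; first by split => //; exact: integrable_of_moment0.
    by apply/eqP; rewrite eq_le Bbeta B_ge// ltW.
have [beta0|beta0|beta0] := ltgtP 0 beta.
- have BE := Hpos beta0; split; last by apply: lower; rewrite BE.
  move=> b bb; have Bc : (B < ((beta + b) / 2)%:E)%E by rewrite BE lte_fin; lra.
  apply: (finite_moment_growth hX _ _ (moment_exponent_lt Bc)); lra.
- have [[_ EX0] BE] := Hneg beta0; split; last by apply: lower; rewrite BE.
  move=> b bb; pose c := (beta + Num.min b 0) / 2.
  have m0 : beta < Num.min b 0 by rewrite lt_min bb.
  have mb : Num.min b 0 <= b by rewrite ge_min lexx.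
  have mz : Num.min b 0 <= 0 by rewrite ge_min lexx orbT.
  have Bc : (B < c%:E)%E by rewrite BE lte_fin /c; lra.
  apply: (centered_growth hX _ _ (moment_exponent_lt Bc) EX0); rewrite /c; lra.
- have [[L0 EX]|BE] := Hzero (esym beta0).
    split=> b; rewrite -beta0 => b0.
      by apply: filterS (noncentered_growth hX L0 EX b0) => w [].
    have nb0 : 0 < - b by rewrite oppr_gt0.
    apply: filterS (noncentered_growth hX L0 EX nb0) => w [_ H] G.
    have [n [/= h1 h2]] := filter_ex (filterI H G).
    by move: h1; rewrite opprK ltNge h2.
  split; last by apply: lower; rewrite BE -beta0.
  move=> b bb; have Bc : (B < (b / 2)%:E)%E by rewrite BE lte_fin; lra.
  apply: (finite_moment_growth hX _ _ (moment_exponent_lt Bc)); lra.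
Unshelve. all: by end_near. Qed.
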